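(* There exists an absolute constant $c>0$ such that for every $n\ge2$ the cross-polytope $B_1^n=\{x\in\mathbb{R}^n:\sum_{i=1}^n|x_i|\le1\}$ satisfies $$d_{\rm w}(B_1^n,\Pi)\ge c\sqrt{n/\log n},$$ where $\Pi$ is the class of projection bodies in $\mathbb{R}^n$.
   Context: $|\cdot|$ of a set denotes volume (Lebesgue measure) of the appropriate dimension. A convex body is a compact convex set with non-empty interior; origin-symmetric means $K=-K$. For $\xi\in S^{n-1}$, $K\vert\xi^\perp$ is the orthogonal projection of $K$ onto the hyperplane through the origin perpendicular to $\xi$. The support function of a convex body $K$ is $h_K(x)=\max\{\langle x,y\rangle: y\in K\}$, and $w(K)=\int_{S^{n-1}}h_K(\xi)\,d\sigma(\xi)$, where $\sigma$ is the normalized (probability) Lebesgue measure on $S^{n-1}$. The projection body $\Pi K$ of an origin-symmetric convex body $K$ is the origin-symmetric convex body with $h_{\Pi K}(\xi)=|K\vert\xi^\perp|$ for all $\xi\in S^{n-1}$. A body is called a projection body if it is the projection body of some convex body; $\Pi$ denotes the class of projection bodies in $\mathbb{R}^n$. The mean width distance is $d_{\rm w}(K,\Pi)=\inf\{w(D)/w(K): K\subset D,\ D\in\Pi\}$. *)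

(* Defs.v *)
From HB Require Import structures.
From mathcomp Require Import all_boot all_order all_algebra.
From mathcomp Require Import all_classical all_reals all_analysis.
From mathcomp Require Import measurable_realfun.
Set Implicit Arguments.
Unset Strict Implicit.
Unset Printing Implicit Defensive.
Import Order.TTheory GRing.Theory Num.Theory.
Import numFieldTopology.Exports numFieldNormedType.Exports.
Local Open Scope classical_set_scope.
Local Open Scope ring_scope.

(* Measurable sets of row vectors: the product sigma-algebra generated by the
   coordinates (equivalently the Borel sets), as for n.-tuple R *)
Fact rV_display : measure_display.
Proof. by constructor. Qed.

Section measurable_rV.
Context (R : realType) (n : nat).

Let coord (i : 'I_n) (x : 'rV[R]_n) : R := x ord0 i.

Let rV_set0 : g_sigma_preimage coord set0.
Proof. exact: sigma_algebra0. Qed.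

Let rV_setC A : g_sigma_preimage coord A -> g_sigma_preimage coord (~` A).
Proof. exact: sigma_algebraC. Qed.

Let rV_bigcup (F : (set 'rV[R]_n)^nat) :
  (forall i, g_sigma_preimage coord (F i)) ->
  g_sigma_preimage coord (\bigcup_i F i).
Proof. exact: sigma_algebra_bigcup. Qed.

HB.instance Definition _ := @isMeasurable.Build rV_display 'rV[R]_n
  (g_sigma_preimage coord) rV_set0 rV_setC rV_bigcup.

Lemma measurable_coord (i : 'I_n) :
  measurable_fun [set: 'rV[R]_n] (fun x : 'rV[R]_n => x ord0 i).
Proof.
move=> _ Y mY; rewrite setTI; apply: sub_sigma_algebra => /=.
rewrite -bigcup_seq/=; exists i => /=; first by rewrite mem_index_enum.
by exists Y => //; rewrite setTI.
Qed.

Lemma measurable_fun_rV d (T : measurableType d) (f : T -> 'rV[R]_n) :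
  (forall i, measurable_fun [set: T] (fun x => f x ord0 i)) ->
  measurable_fun [set: T] f.
Proof.
move=> mf _ A mA; rewrite setTI.
pose S := [set B : set 'rV[R]_n | measurable (f @^-1` B)].
suff : (measurable : set_system 'rV[R]_n) `<=` S by apply.
apply: smallest_sub.
  split => [|B SB|F SF]; rewrite /S /=.
  - by rewrite preimage_set0.
  - by rewrite setTD preimage_setC; exact: measurableC.
  - by rewrite preimage_bigcup; apply: bigcupT_measurable.
rewrite -bigcup_seq => B [i _ [Y mY <-]].
by have := mf i measurableT Y mY; rewrite !setTI.
Qed.

End measurable_rV.

Section lebesgue_rV.
Local Open Scope ereal_scope.
Context (R : realType).

Section lebesgue_rV_succ.
Context (n : nat) (mu : {sigma_finite_measure set 'rV[R]_n -> \bar R}).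

Definition cons_rV (p : R * 'rV[R]_n) : 'rV[R]_n.+1 :=
  \row_i oapp (p.2 ord0) p.1 (unlift ord0 i).

Lemma measurable_cons_rV : measurable_fun [set: R * 'rV[R]_n] cons_rV.
Proof.
apply: measurable_fun_rV => i; rewrite /cons_rV.
under eq_fun do rewrite mxE.
case: (unliftP ord0 i) => [j _|_] /=; last exact: measurable_fst.
by apply: (measurableT_comp (measurable_coord j)); exact: measurable_snd.
Qed.

Definition uncons_rV (x : 'rV[R]_n.+1) : R * 'rV[R]_n :=
  (x ord0 ord0, \row_i x ord0 (lift ord0 i)).

Lemma cons_rVK : cancel cons_rV uncons_rV.
Proof.
case=> a x; rewrite /cons_rV /uncons_rV mxE unlift_none; congr pair.
by apply/rowP => i; rewrite !mxE liftK.
Qed.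

Lemma measurable_uncons_rV : measurable_fun [set: 'rV[R]_n.+1] uncons_rV.
Proof.
apply: measurable_fun_pair; first exact: measurable_coord.
apply: measurable_fun_rV => i; under eq_fun do rewrite mxE.
exact: measurable_coord.
Qed.

Definition lebesgue_rV_succ : set 'rV[R]_n.+1 -> \bar R :=
  pushforward (@lebesgue_measure R \x mu) cons_rV.

Let succ0 : lebesgue_rV_succ set0 = 0.
Proof. exact: (measure0 (@lebesgue_measure R \x mu)). Qed.

Let succ_ge0 A : 0 <= lebesgue_rV_succ A.
Proof. exact: (measure_ge0 (@lebesgue_measure R \x mu)). Qed.

Let succ_additive : semi_sigma_additive lebesgue_rV_succ.
Proof.
by apply: measure_semi_sigma_additive; exact: measurable_cons_rV.
Qed.

HB.instance Definition _ := isMeasure.Build _ _ _ lebesgue_rV_succ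
  succ0 succ_ge0 succ_additive.

Let succ_sigma_finite : sigma_finite setT lebesgue_rV_succ.
Proof.
have /sigma_finiteP[F [FT ndF mF]] := sigma_finiteT (@lebesgue_measure R).
have /sigma_finiteP[G [GT ndG mG]] := sigma_finiteT mu.
exists (fun k => uncons_rV @^-1` (F k `*` G k)).
  rewrite -preimage_bigcup; apply/esym; rewrite -subTset => x _ /=.
  have [i _ Fi] : (\bigcup_i F i) (uncons_rV x).1 by rewrite -FT.
  have [j _ Gj] : (\bigcup_i G i) (uncons_rV x).2 by rewrite -GT.
  exists (maxn i j) => //; split.
    by apply: (subsetPset _ _ (ndF _ _ (leq_maxl i j))).
  by apply: (subsetPset _ _ (ndG _ _ (leq_maxr i j))).
move=> k; have [mFk Fk] := mF k; have [mGk Gk] := mG k; split.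
  rewrite -[X in measurable X]setTI; apply: measurable_uncons_rV => //.
  exact: measurableX.
rewrite /lebesgue_rV_succ /pushforward -comp_preimage.
have -> : uncons_rV \o cons_rV = id by apply/funext => p /=; rewrite cons_rVK.
rewrite preimage_id.
by rewrite product_measure1E// lte_mul_pinfty// ge0_fin_numE.
Qed.

HB.instance Definition _ := Measure_isSigmaFinite.Build _ _ _ lebesgue_rV_succ
  succ_sigma_finite.

End lebesgue_rV_succ.

Fixpoint lebesgue_rV (n : nat) :
    {sigma_finite_measure set 'rV[R]_n -> \bar R} :=
  if n is m.+1 then lebesgue_rV_succ (lebesgue_rV m) else \d_(0 : 'rV[R]_0)%R.

End lebesgue_rV.

Section euclidean.
Context (R : realType) (n : nat).
Implicit Types (x y : 'rV[R]_n) (K D : set 'rV[R]_n).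

Definition dotp x y : R := \sum_i x ord0 i * y ord0 i.
Definition norm2 x : R := Num.sqrt (dotp x x).
Definition ball2 : set 'rV[R]_n := [set x | norm2 x <= 1].
Definition sphere : set 'rV[R]_n := [set x | norm2 x = 1].
Definition cross_polytope : set 'rV[R]_n := [set x | \sum_i `|x ord0 i| <= 1].

Definition direction x : 'rV[R]_n := (norm2 x)^-1 *: x.

Lemma measurable_norm2 : measurable_fun [set: 'rV[R]_n] norm2.
Proof.
apply: (measurableT_comp (f := @Num.sqrt R)).
  exact: continuous_measurable_fun (@sqrt_continuous R).
by apply: measurable_sum => i; apply: measurable_funM; exact: measurable_coord.
Qed.

Lemma measurable_ball2 : measurable ball2.
Proof.
rewrite (_ : ball2 = [set: 'rV[R]_n] `&` norm2 @^-1` `]-oo, 1]).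
  by apply: measurable_norm2.
by rewrite setTI; apply/seteqP; split => x /=; rewrite in_itv.
Qed.

Lemma measurable_direction : measurable_fun [set: 'rV[R]_n] direction.
Proof.
apply: measurable_fun_rV => i.
rewrite (_ : (fun _ => _) = (fun x => norm2 x `^ (-1) * x ord0 i)).
  apply: measurable_funM; last exact: measurable_coord.
  exact: measurableT_comp (measurable_powR _) measurable_norm2.
by apply/funext => x; rewrite mxE powR_inv1// sqrtr_ge0.
Qed.

Definition cone_measure : set 'rV[R]_n -> \bar R :=
  pushforward (mrestr (lebesgue_rV R n) measurable_ball2) direction.

End euclidean.

Section cone_measure_is_measure.
Context (R : realType) (n : nat).
Local Notation cone_measure := (@cone_measure R n).

Let cone0 : cone_measure set0 = 0%E.
Proof. by apply: measure0; exact: measurable_direction. Qed.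

Let cone_ge0 A : (0 <= cone_measure A)%E.
Proof. by apply: measure_ge0; exact: measurable_direction. Qed.

Let cone_additive : semi_sigma_additive cone_measure.
Proof. by apply: measure_semi_sigma_additive; exact: measurable_direction. Qed.

HB.instance Definition _ := isMeasure.Build _ _ _ cone_measure
  cone0 cone_ge0 cone_additive.

End cone_measure_is_measure.

Section mean_width_distance.
Context (R : realType) (n : nat).
Implicit Types (x y : 'rV[R]_n) (K D : set 'rV[R]_n).

Fact inv_volume_ball2_ge0 : 0 <= (fine (lebesgue_rV R n (@ball2 R n)))^-1.
Proof. by rewrite invr_ge0 fine_ge0. Qed.

(* Normalised rotation-invariant measure on the sphere, in polar-coordinate
   form: sphere_measure A = |{x in B : x / |x| in A}| / |B|, B the unit ball,
   viewed as a measure on the whole space that is carried by the sphere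
   (the centre, where x / |x| is 0, is negligible for n >= 1). *)
Definition sphere_measure : set 'rV[R]_n -> \bar R :=
  mscale (NngNum inv_volume_ball2_ge0) (@cone_measure R n).

HB.instance Definition _ := Measure.on sphere_measure.

Definition convex_body K := [/\ convex_set K, compact K & K° !=set0].

Definition origin_symmetric K := K = [set - x | x in K].

Definition support_fun K x : R := sup [set dotp x y | y in K].

Definition mean_width K : R :=
  \int[sphere_measure]_(xi in @sphere R n) support_fun K xi.

(* K | xi^\perp when |xi| = 1 *)
Definition proj_hyperplane (xi : 'rV[R]_n) K : set 'rV[R]_n :=
  [set x - dotp x xi *: xi | x in K].

(* Rows: an orthonormal basis of xi^\perp, available for |xi| = 1 *)
Definition hyperplane_basis (xi : 'rV[R]_n) : 'M[R]_(n.-1, n) :=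
  xget 0 [set F | F *m F^T = 1%:M /\ F *m xi^T = 0].

(* (n-1)-dimensional volume of A `<=` xi^\perp, computed in the coordinates of
   an orthonormal basis of xi^\perp; it does not depend on the basis chosen *)
Definition hyperplane_volume (xi : 'rV[R]_n) (A : set 'rV[R]_n) : \bar R :=
  lebesgue_rV R n.-1 [set y | A (y *m hyperplane_basis xi)].

Definition projection_body_of K D :=
  [/\ convex_body D, origin_symmetric D &
    forall xi, sphere xi ->
      (support_fun D xi)%:E = hyperplane_volume xi (proj_hyperplane xi K)].

Definition projection_body D :=
  exists2 K, convex_body K & projection_body_of K D.

Definition mean_width_dist K (C : set (set 'rV[R]_n)) : R :=
  inf [set mean_width D / mean_width K | D in [set D | K `<=` D /\ C D]].

End mean_width_distance.

Arguments cross_polytope R n : clear implicits.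

(* Main.v *)
Require Import Defs.
From mathcomp Require Import all_boot all_order all_algebra.
From mathcomp Require Import all_classical all_reals all_analysis.
From mathcomp Require Import measurable_realfun.
From mathcomp Require Import ring lra.
Import Order.TTheory GRing.Theory Num.Theory.
Import numFieldTopology.Exports numFieldNormedType.Exports.
Set Implicit Arguments.
Unset Strict Implicit.
Unset Printing Implicit Defensive.
Local Open Scope classical_set_scope.
Local Open Scope ring_scope.

(** Write w for the mean width, e_j for the standard basis, h for the support
function of a projection body D of K that contains the cross-polytope B, and
f for the indicator function of K.

The numerator and the denominator of w(D) / w(B) are estimated separately.
The support function of B is the maximum of the |x_j|, and a cap of the sphere
of height s has measure at most (1 - s^2)^(n/2) [sphere_cap_le], so a union
bound over the 2n caps around the points e_j and - e_j gives
w(B) <= 4 sqrt (log n / n) [cross_polytope_width_le].  The point is that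
w(D) >= 1/72, a bound free of the dimension [projection_body_width].

The reason is that h is the norm of a subspace of L1: by slicing K along lines,
h(v) is the limit of || f(. + t v) - f ||_1 / (2 t) as t -> 0
[jumpK_int_le, jumpK_int_ge].  If f were smooth, f(. + t v) - f would be
t <grad f, v> up to o(t), which is linear in v, and Khintchine's inequality
applied at every point and integrated would give
    sum_j |x_j| h(e_j) <= C sqrt n * (average over signs of h(+-x_1, .., +-x_n)).
The indicator function of a convex body is not smooth, but linearity is only
needed in the L1 norm; it is enough to average f over the translates by a
discrete box whose mesh is much smaller than its width, because the mixed second
differences of such an average are small [smoothing_transfer].
The resulting inequality is [projection_average].  Now h(e_j) >= 1 because D
contains B, the law of a point x on the sphere is unchanged by sign changes, and
the mean of sum_j |x_j| is of order sqrt n; integrating over the sphere gives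
sqrt n <= C' sqrt n * w(D).

The measure on the sphere is defined through the volume of cones in the unit
ball, so every integral above reduces to volumes.  What is used about Lebesgue
measure is translation invariance, obtained from its construction as an iterated
product, and invariance under orthogonal maps and scaling, which follows from
translation invariance by the argument that proves uniqueness of Haar measure
[haar_swap].

The infimum that defines the distance would be 0 over an empty family; balls show
that some projection body contains B [ball_projection_body]. *)

Lemma bernoulli_ineq (R : realFieldType) k (d : R) : 0 <= d -> d <= 1 ->
  1 - k%:R * d <= (1 - d) ^+ k.
Proof.
move=> d0 d1; elim: k => [|k IH]; first by rewrite mul0r subr0 expr0.
rewrite exprS -[k.+1%:R]natr1.
have : (1 - d) * (1 - k%:R * d) <= (1 - d) * (1 - d) ^+ k.
  by rewrite ler_wpM2l//; lra.
have : 0 <= k%:R * d * d by rewrite !mulr_ge0.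
lra.
Qed.

(** * Lebesgue measure on row vectors *)

Section image_measure.
Context d1 d2 (X : measurableType d1) (Y : measurableType d2) (R : realType).
Variables (phi : X -> Y) (mphi : measurable_fun [set: X] phi).
Variable mu : {measure set X -> \bar R}.

(** The same set function as [pushforward mu phi], with its measure structure
attached to the given proof that phi is measurable. *)
Definition image_measure : {measure set Y -> \bar R} :=
  measure_function_pushforward__canonical__measure_function_Measure mu mphi.

End image_measure.

Lemma lebesgue_measure_translate (R : realType) (a : R) (A : set R) :
  measurable A ->
  lebesgue_measure ((fun x : R => x + a) @^-1` A) = lebesgue_measure A.
Proof.
move=> mA.
have ma : measurable_fun [set: measurableTypeR R]
    (fun x : measurableTypeR R => (x + a : measurableTypeR R)).
  exact: measurable_funD.
symmetry.
apply: (lebesgue_measure_unique (mu := image_measure ma lebesgue_measure)) => //.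
move=> _ [[b c] _ <-] /=.
rewrite /pushforward /=.
rewrite (_ : _ @^-1` _ = `]b - a, c - a]%classic); last first.
  by apply/seteqP; split => x /=; rewrite !in_itv/= ltrBlDr lerBrDr.
rewrite !lebesgue_measure_itv /= !lte_fin ltrD2r.
by case: ifP => // _; rewrite -!EFinB; congr EFin; ring.
Qed.

Section lebesgue_rV_theory.
Context (R : realType).
Local Notation mu := (lebesgue_rV R).

Lemma measurable_rV_shift n (v : 'rV[R]_n) :
  measurable_fun [set: 'rV[R]_n] (fun x => x + v).
Proof.
apply: measurable_fun_rV => i; under eq_fun do rewrite mxE.
by apply: measurable_funD => //; exact: measurable_coord.
Qed.

Lemma measurable_rV_mul m n (Q : 'M[R]_(m, n)) :
  measurable_fun [set: 'rV[R]_m] (fun x => x *m Q).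
Proof.
apply: measurable_fun_rV => i; under eq_fun do rewrite mxE.
apply: measurable_sum => j; apply: measurable_funM => //.
exact: measurable_coord.
Qed.

Lemma measurable_rV_scale n (r : R) :
  measurable_fun [set: 'rV[R]_n] (fun x => r *: x).
Proof.
have -> : (fun x : 'rV[R]_n => r *: x) = (fun x => x *m r%:M).
  by apply/funext => x; rewrite mul_mx_scalar.
exact: measurable_rV_mul.
Qed.

Lemma measurable_preimage d1 d2 (X : measurableType d1) (Y : measurableType d2)
    (f : X -> Y) (A : set Y) :
  measurable_fun [set: X] f -> measurable A -> measurable (f @^-1` A).
Proof. by move=> mf mA; rewrite -[X in measurable X]setTI; exact: mf. Qed.

Lemma lebesgue_rVS n (A : set 'rV[R]_n.+1) :
  mu n.+1 A = (@lebesgue_measure R \x mu n)%E (@cons_rV R n @^-1` A).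
Proof. by []. Qed.

(** By uniqueness of product measures: translation acts on each factor of the
product defining the measure in one more dimension. *)
Lemma lebesgue_rV_translate n (v : 'rV[R]_n) (A : set 'rV[R]_n) :
  measurable A -> mu n ((fun x => x + v) @^-1` A) = mu n A.
Proof.
elim: n v A => [|n IH] v A mA.
  congr (mu 0%N _); apply/funext => x /=; congr (A _).
  by apply/rowP => -[].
rewrite !lebesgue_rVS.
pose w : 'rV[R]_n := \row_i v ord0 (lift ord0 i).
pose sh := fun p : measurableTypeR R * 'rV[R]_n =>
  ((p.1 + v ord0 ord0 : measurableTypeR R), p.2 + w).
have msh : measurable_fun [set: measurableTypeR R * 'rV[R]_n] sh.
  apply: measurable_fun_pair.
    by apply: measurable_funD => //; exact: measurable_fst.
  by apply: measurableT_comp (measurable_rV_shift w) _; exact: measurable_snd.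
rewrite (_ : _ @^-1` _ = sh @^-1` (@cons_rV R n @^-1` A)); last first.
  apply/funext => -[s y] /=; congr (A _); apply/rowP => i.
  by rewrite !mxE; case: (unliftP ord0 i) => [j ->|->] /=; rewrite ?mxE.
symmetry; apply: (product_measure_unique
  (m' := image_measure msh (@lebesgue_measure R \x mu n)%E)); last first.
  by rewrite -[X in measurable X]setTI; exact: measurable_cons_rV.
move=> B C mB mC /=; rewrite /pushforward /=.
rewrite (_ : _ @^-1` _ = ((fun s => s + v ord0 ord0) @^-1` B)
  `*` ((fun y => y + w) @^-1` C)); last by apply/seteqP; split => -[s y].
have ms : measurable_fun [set: measurableTypeR R]
    (fun s : measurableTypeR R => (s + v ord0 ord0 : measurableTypeR R)).
  exact: measurable_funD.
rewrite product_measure1E.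
- by rewrite IH//; congr (_ * _)%E; exact: lebesgue_measure_translate.
- by rewrite -[X in measurable X]setTI; exact: ms.
- exact: measurable_preimage (measurable_rV_shift w) mC.
Qed.

(** The ball of the maximum norm; its volume is known exactly, and it serves as
the reference body. *)
Definition cube n (r : R) : set 'rV[R]_n := [set x | forall i, `|x ord0 i| <= r].

Lemma measurable_cube n r : measurable (@cube n r).
Proof.
have -> : cube r = \bigcap_(i in [set: 'I_n])
    [set x : 'rV[R]_n | `|x ord0 i| <= r].
  by apply/seteqP; split => [x /= h i _ /=|x h i]; [exact: h|exact: h].
apply: fin_bigcap_measurable => // i _.
have -> : [set x : 'rV[R]_n | `|x ord0 i| <= r] =
    (fun x : 'rV[R]_n => x ord0 i) @^-1` `[- r, r].
  by apply/seteqP; split => x /=; rewrite in_itv/= ler_norml.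
exact: measurable_preimage (measurable_coord i) _.
Qed.

Lemma lebesgue_rV_cube n (r : R) : 0 <= r -> mu n (cube r) = ((2 * r) ^+ n)%:E.
Proof.
move=> r0; elim: n => [|n IH].
  rewrite expr0 /= diracE mem_set//.
  by case.
rewrite lebesgue_rVS (_ : _ @^-1` _ = `[- r, r]%classic `*` cube r).
  rewrite product_measure1E ?IH//=; last exact: measurable_cube.
  rewrite lebesgue_measure_itv/= lte_fin.
  have [h|h] := ltP (- r) r.
    by rewrite -EFinB -EFinM exprS; congr (EFin (_ * _)); ring.
  rewrite mul0e (_ : r = 0) ?mulr0 ?expr0n//.
  by apply/eqP; rewrite eq_le r0 andbT; lra.
apply/seteqP; split => -[s y] /=.
  move=> h; split; first by have := h ord0; rewrite mxE unlift_none in_itv/= ler_norml.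
  by move=> i; have := h (lift ord0 i); rewrite mxE liftK.
rewrite in_itv/= => -[h1 h2] i; rewrite mxE.
by case: (unliftP ord0 i) => [j _|_] /=; [exact: h2|rewrite ler_norml].
Qed.

Lemma measurable_slab n (j : 'I_n) (a : R) :
  measurable [set x : 'rV[R]_n | `|x ord0 j| < a].
Proof.
rewrite (_ : mkset _ = (fun x : 'rV[R]_n => x ord0 j) @^-1` `]- a, a[).
  exact: measurable_preimage (measurable_coord j) _.
by apply/seteqP; split => x /=; rewrite in_itv/= ltr_norml.
Qed.

Lemma measurable_halfspace n (e : 'rV[R]_n) (s : R) :
  measurable [set x : 'rV[R]_n | s <= dotp x e].
Proof.
rewrite (_ : mkset _ = (fun x : 'rV[R]_n => dotp x e) @^-1` `[s, +oo[).
  apply: measurable_preimage; last exact: measurable_itv.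
  by apply: measurable_sum => i; apply: measurable_funM => //; exact: measurable_coord.
by apply/seteqP; split => x /=; rewrite in_itv/= andbT.
Qed.

Lemma measurable_rV_add n :
  measurable_fun [set: 'rV[R]_n * 'rV[R]_n] (fun p => p.1 + p.2).
Proof.
apply: measurable_fun_rV => i; under eq_fun do rewrite mxE.
by apply: measurable_funD; apply: measurableT_comp (measurable_coord i) _;
  [exact: measurable_fst|exact: measurable_snd].
Qed.

Lemma measurable_rV_lin n (f g : 'rV[R]_n -> 'rV[R]_n) :
  measurable_fun setT f -> measurable_fun setT g ->
  measurable_fun [set: 'rV[R]_n] (fun x => f x + g x).
Proof.
move=> mf mg; apply: (measurableT_comp (@measurable_rV_add n)
  (measurable_fun_pair mf mg)).
Qed.

Local Open Scope ereal_scope.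

Lemma lebesgue_rV_int_translate n (v : 'rV[R]_n) (f : 'rV[R]_n -> \bar R) :
  measurable_fun setT f -> (forall x, 0 <= f x) ->
  \int[mu n]_x f (x + v)%R = \int[mu n]_x f x.
Proof.
move=> mf f0.
transitivity (\int[pushforward (mu n) (fun x => x + v)%R]_x f x).
  by rewrite (ge0_integral_pushforward (measurable_rV_shift v)).
apply: (eq_measure_integral (m1 := image_measure (measurable_rV_shift v) (mu n))
  (mu n)) => A mA _.
exact: lebesgue_rV_translate.
Qed.

Lemma lebesgue_rV_int_indic n (A : set 'rV[R]_n) : measurable A ->
  \int[mu n]_x (\1_A x)%:E = mu n A.
Proof. by move=> mA; rewrite integral_indic// setIT. Qed.

(** The proof of uniqueness of Haar measure, for the translation invariant measure
[nu A = mu ((fun x => x *m Q) @^-1` A)]: integrate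
[\1_A (x Q) * \1_B (x Q + y)] over x and y in both orders.  Integrating in y first
gives [nu A * mu B]; translating x by [y P] and then integrating in y first gives
[nu B * mu (- A)].  A set B of known measure then determines nu. *)
Lemma haar_swap n (P Q : 'M[R]_n) (A B : set 'rV[R]_n) :
  (P *m Q = 1%:M)%R -> measurable A -> measurable B ->
  mu n ((fun x => x *m Q)%R @^-1` A) * mu n B =
  mu n ((fun x => x *m Q)%R @^-1` B) * mu n ((fun x => - x)%R @^-1` A).
Proof.
move=> PQ mA mB.
have PQx (y : 'rV[R]_n) : (y *m P *m Q = y)%R by rewrite -mulmxA PQ mulmx1.
have mq := measurable_rV_mul Q.
have mN : measurable_fun [set: 'rV[R]_n] (fun x : 'rV[R]_n => - x)%R.
  under eq_fun do rewrite -scaleN1r.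
  exact: measurable_rV_scale.
pose phi := fun p : 'rV[R]_n * 'rV[R]_n =>
  (\1_A (p.1 *m Q)%R * \1_B (p.1 *m Q + p.2)%R)%:E : \bar R.
have m1 : measurable_fun [set: 'rV[R]_n * 'rV[R]_n] (fun p => p.1 *m Q)%R.
  exact: measurableT_comp mq measurable_fst.
have mphi : measurable_fun setT phi.
  apply/measurable_EFinP; apply: measurable_funM.
    exact: measurableT_comp (measurable_indic mA) m1.
  apply: measurableT_comp (measurable_indic mB) _.
  apply: (measurableT_comp (@measurable_rV_add n) (measurable_fun_pair m1 _)).
  exact: measurable_snd.
have phi0 x : 0 <= phi x by rewrite /phi lee_fin mulr_ge0.
have := fubini_tonelli (m1 := mu n) (m2 := mu n) phi mphi phi0.
have -> : \int[mu n]_x \int[mu n]_y phi (x, y) =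
    mu n ((fun x => x *m Q)%R @^-1` A) * mu n B.
  rewrite -lebesgue_rV_int_indic; last exact: measurable_preimage.
  rewrite -ge0_integralZr//; last first.
    apply/measurable_EFinP; apply: measurable_indic; exact: measurable_preimage.
  apply: eq_integral => x _; rewrite /phi /=.
  under eq_integral do rewrite EFinM.
  rewrite ge0_integralZl//; last first.
    apply/measurable_EFinP; apply: measurableT_comp (measurable_indic mB) _.
    apply: measurable_rV_lin => //; exact: measurable_cst.
  congr (_ * _).
  under eq_integral do rewrite addrC.
  rewrite (@lebesgue_rV_int_translate n (x *m Q)%R (fun y => (\1_B y)%:E))//.
    exact: lebesgue_rV_int_indic.
  by apply/measurable_EFinP.
move=> ->.
transitivity (\int[mu n]_y \int[mu n]_x
    (\1_A (x *m Q - y)%R * \1_B (x *m Q)%R)%:E).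
  apply: eq_integral => y _; rewrite /phi /=.
  rewrite -(@lebesgue_rV_int_translate n (y *m P)%R
    (fun x => (\1_A (x *m Q - y)%R * \1_B (x *m Q)%R)%:E)).
  - by apply: eq_integral => x _; rewrite mulmxDl PQx addrK.
  - apply/measurable_EFinP; apply: measurable_funM.
      apply: measurableT_comp (measurable_indic mA) _.
      by apply: measurable_rV_lin => //; exact: measurable_cst.
    exact: measurableT_comp (measurable_indic mB) mq.
  - by move=> x; rewrite lee_fin mulr_ge0.
rewrite -(fubini_tonelli (m1 := mu n) (m2 := mu n)
  (fun p => (\1_A (p.1 *m Q - p.2)%R * \1_B (p.1 *m Q)%R)%:E)); last 2 first.
- apply/measurable_EFinP; apply: measurable_funM.
    apply: measurableT_comp (measurable_indic mA) _.
    apply: (measurableT_comp (@measurable_rV_add n) (measurable_fun_pair m1 _)).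
    exact: measurableT_comp mN measurable_snd.
  exact: measurableT_comp (measurable_indic mB) m1.
- by move=> x; rewrite lee_fin mulr_ge0.
rewrite -lebesgue_rV_int_indic; last exact: measurable_preimage.
rewrite -ge0_integralZr//; last first.
  apply/measurable_EFinP; apply: measurable_indic; exact: measurable_preimage.
apply: eq_integral => x _ /=.
under eq_integral do rewrite mulrC EFinM.
rewrite ge0_integralZl//; last first.
  apply/measurable_EFinP; apply: measurableT_comp (measurable_indic mA) _.
  apply: measurable_rV_lin => //; exact: measurable_cst.
congr (_ * _).
transitivity (\int[mu n]_y (\1_A (- (y - x *m Q))%R)%:E).
  by apply: eq_integral => y _; rewrite opprB.
rewrite (@lebesgue_rV_int_translate n (- (x *m Q))%R (fun y => (\1_A (- y)%R)%:E))//.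
  rewrite -lebesgue_rV_int_indic//; exact: measurable_preimage.
by apply/measurable_EFinP; exact: measurableT_comp (measurable_indic mA) mN.
Qed.

End lebesgue_rV_theory.

(** * Euclidean geometry *)

Section euclid_basics.
Context (R : realType) (n : nat).
Implicit Types x y z : 'rV[R]_n.

Lemma dotpE x y : dotp x y = (x *m y^T) ord0 ord0.
Proof. by rewrite mxE; apply: eq_bigr => i _; rewrite mxE. Qed.

Lemma dotpC x y : dotp x y = dotp y x.
Proof. by apply: eq_bigr => i _; rewrite mulrC. Qed.

Lemma dotpDl x y z : dotp (x + y) z = dotp x z + dotp y z.
Proof. by rewrite !dotpE mulmxDl mxE. Qed.

Lemma dotpZl a x z : dotp (a *: x) z = a * dotp x z.
Proof. by rewrite !dotpE -scalemxAl mxE. Qed.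

Lemma dotpDr x y z : dotp z (x + y) = dotp z x + dotp z y.
Proof. by rewrite dotpC dotpDl !(dotpC z). Qed.

Lemma dotpZr a x z : dotp z (a *: x) = a * dotp z x.
Proof. by rewrite dotpC dotpZl dotpC. Qed.

Lemma dotpNr x y : dotp x (- y) = - dotp x y.
Proof. by rewrite -scaleN1r dotpZr mulN1r. Qed.

Lemma dotp_ge0 x : 0 <= dotp x x.
Proof. by apply: sumr_ge0 => i _; rewrite -expr2 sqr_ge0. Qed.

Lemma norm2_ge0 x : 0 <= norm2 x. Proof. exact: sqrtr_ge0. Qed.

Lemma norm2_sqr x : norm2 x ^+ 2 = dotp x x.
Proof. by rewrite sqr_sqrtr// dotp_ge0. Qed.

Lemma norm2Z a x : norm2 (a *: x) = `|a| * norm2 x.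
Proof.
by rewrite /norm2 dotpZl dotpZr mulrA -expr2 sqrtrM ?sqr_ge0// sqrtr_sqr.
Qed.

Lemma norm2_le1 x : (norm2 x <= 1) = (dotp x x <= 1).
Proof. by rewrite -norm2_sqr expr_le1// norm2_ge0. Qed.

Lemma norm2_eq1 x : norm2 x = 1 <-> dotp x x = 1.
Proof.
split=> [h|h]; first by rewrite -norm2_sqr h expr1n.
by rewrite /norm2 h sqrtr1.
Qed.

Lemma dotp_axis x a j : dotp x (a *: delta_mx ord0 j) = a * x ord0 j.
Proof.
rewrite dotpZr /dotp (bigD1 j)//= !mxE !eqxx mulr1 big1 ?addr0// => i ij.
by rewrite mxE (negbTE ij) andbF mulr0.
Qed.

Lemma dotp_delta x j : dotp x (delta_mx ord0 j) = x ord0 j.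
Proof. by rewrite -[delta_mx _ _]scale1r dotp_axis mul1r. Qed.

Lemma norm2_axis a j : norm2 (a *: delta_mx ord0 j : 'rV[R]_n) = `|a|.
Proof.
rewrite norm2Z (norm2_eq1 _).2 ?mulr1//.
by rewrite dotp_delta mxE !eqxx.
Qed.

Lemma cross_polytope_axis a j : `|a| <= 1 ->
  cross_polytope R n (a *: delta_mx ord0 j).
Proof.
move=> a1; rewrite /cross_polytope /= (bigD1 j)//= !mxE !eqxx mulr1 big1 ?addr0//.
by move=> i ij; rewrite !mxE (negbTE ij) andbF mulr0 normr0.
Qed.

Lemma coord_le_norm2 x i : `|x ord0 i| <= norm2 x.
Proof.
rewrite -(@ler_pXn2r _ 2)// ?nnegrE ?norm2_ge0// norm2_sqr real_normK ?num_real//.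
by rewrite /dotp (bigD1 i)//= -expr2 lerDl sumr_ge0// => j _; rewrite -expr2 sqr_ge0.
Qed.

Lemma norm2_eq0 x : norm2 x = 0 -> x = 0.
Proof.
move=> h; apply/rowP => i; rewrite mxE; apply/eqP; rewrite -normr_eq0.
by rewrite eq_le normr_ge0 andbT -h coord_le_norm2.
Qed.

(** Expand the square of the norm of [|y| x - |x| y]. *)
Lemma cauchy_schwarz x y : dotp x y <= norm2 x * norm2 y.
Proof.
have [/norm2_eq0 ->|x0] := eqVneq (norm2 x) 0.
  by rewrite -(scale0r (0 : 'rV[R]_n)) norm2Z dotpZl normr0 !mul0r.
have [/norm2_eq0 ->|y0] := eqVneq (norm2 y) 0.
  by rewrite -(scale0r (0 : 'rV[R]_n)) norm2Z dotpZr normr0 !(mul0r, mulr0).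
have {}x0 : 0 < norm2 x by rewrite lt_def x0 norm2_ge0.
have {}y0 : 0 < norm2 y by rewrite lt_def y0 norm2_ge0.
have := dotp_ge0 (norm2 y *: x - norm2 x *: y).
rewrite dotpDl !dotpDr !dotpNr -!scaleNr !dotpZl !dotpZr -!norm2_sqr.
rewrite (dotpC y) => h.
rewrite -(ler_pM2l (mulr_gt0 x0 y0)); move: h; lra.
Qed.

End euclid_basics.

Section euclid_basics_mul.
Context (R : realType) (n : nat).
Implicit Types x y z : 'rV[R]_n.

Lemma dotp_mul m (Q : 'M[R]_(n, m)) x y : Q *m Q^T = 1%:M ->
  dotp (x *m Q) (y *m Q) = dotp x y.
Proof. by move=> hQ; rewrite !dotpE trmx_mul mulmxA -(mulmxA x) hQ mulmx1. Qed.

Lemma norm2_mul m (Q : 'M[R]_(n, m)) x : Q *m Q^T = 1%:M ->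
  norm2 (x *m Q) = norm2 x.
Proof. by move=> hQ; rewrite /norm2 dotp_mul. Qed.

Lemma cube_sub_ball2 : @cube R n n.+1%:R^-1 `<=` @ball2 R n.
Proof.
move=> x hx; rewrite /ball2 /= norm2_le1 /dotp.
apply: (@le_trans _ _ (\sum_(i < n) n.+1%:R^-1)).
  apply: ler_sum => i _; rewrite -expr2 -[_ ^+ 2]real_normK ?num_real// expr2.
  rewrite -[leRHS]mulr1 ler_pM//; apply: le_trans (hx i) _ => //.
  by rewrite invf_le1// ler1n.
rewrite sumr_const card_ord -[_ *+ _]mulr_natl ler_pdivrMr// mul1r ler_nat//.
Qed.

Lemma ball2_sub_cube : @ball2 R n `<=` @cube R n 1.
Proof. by move=> x /= hx i; apply: le_trans hx; exact: coord_le_norm2. Qed.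

End euclid_basics_mul.

(** * Invariance of Lebesgue measure under orthogonal maps and scaling *)

Section invariance.
Context (R : realType) (n : nat).
Local Notation mu := (lebesgue_rV R n).

Lemma ball2_gt0 : (0 < mu (@ball2 R n))%E.
Proof.
apply: (@lt_le_trans _ _ (mu (cube n.+1%:R^-1))).
  by rewrite lebesgue_rV_cube// lte_fin exprn_gt0// mulr_gt0.
apply: le_measure; rewrite ?inE; [exact: measurable_cube|exact: measurable_ball2|].
exact: cube_sub_ball2.
Qed.

Lemma ball2_lty : (mu (@ball2 R n) < +oo)%E.
Proof.
apply: (@le_lt_trans _ _ (mu (cube 1))); last first.
  by rewrite lebesgue_rV_cube// ltry.
apply: le_measure; rewrite ?inE; [exact: measurable_ball2|exact: measurable_cube|].
exact: ball2_sub_cube.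
Qed.

(** [haar_swap] for the identity map, with a cube as reference set. *)
Lemma lebesgue_rV_opp (A : set 'rV[R]_n) : measurable A ->
  mu ((fun x => - x) @^-1` A) = mu A.
Proof.
move=> mA; have := @haar_swap R n 1%:M 1%:M A (cube 1) (mulmx1 _) mA (measurable_cube _).
have E B : (fun x : 'rV[R]_n => x *m 1%:M) @^-1` B = B.
  by apply/funext => x; rewrite /= mulmx1.
rewrite !E muleC => /esym; rewrite lebesgue_rV_cube//.
move=> /(congr1 (fun z => (((2 * 1) ^+ n)^-1%:E * z)%E)).
by rewrite !muleA -EFinM mulVf ?mul1e// expf_neq0// mulr1.
Qed.

(** [haar_swap] with the unit ball, which Q preserves, as reference set. *)
Lemma lebesgue_rV_orthogonal (Q : 'M[R]_n) (A : set 'rV[R]_n) :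
  Q *m Q^T = 1%:M -> measurable A -> mu ((fun x => x *m Q) @^-1` A) = mu A.
Proof.
move=> hQ mA.
have := @haar_swap R n Q^T Q A (@ball2 R n) (mulmx1C hQ) mA (@measurable_ball2 R n).
rewrite lebesgue_rV_opp//.
rewrite (_ : _ @^-1` @ball2 R n = @ball2 R n); last first.
  by apply/funext => x; rewrite /ball2 /= norm2_mul.
have b0 := ball2_gt0; have b1 := ball2_lty.
have bE : mu (@ball2 R n) = (fine (mu (@ball2 R n)))%:E by rewrite fineK// ge0_fin_numE.
have f0 : fine (mu (@ball2 R n)) != 0 by rewrite gt_eqF// fine_gt0// b0 b1.
rewrite bE muleC.
move=> /(congr1 (fun z => (((fine (mu (@ball2 R n)))^-1)%:E * z)%E)).
by rewrite !muleA -EFinM mulVf ?mul1e.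
Qed.

(** [haar_swap] with a cube, whose dilates have known volume, as reference set. *)
Lemma lebesgue_rV_scale (r : R) (A : set 'rV[R]_n) :
  0 < r -> measurable A -> mu ((fun x => r *: x) @^-1` A) = ((r^-1 ^+ n)%:E * mu A)%E.
Proof.
move=> r0 mA.
have rr : r^-1%:M *m r%:M = 1%:M :> 'M[R]_n.
  by rewrite -scalar_mxM mulVf// gt_eqF.
have := @haar_swap R n r^-1%:M r%:M A (cube 1) rr mA (measurable_cube _).
rewrite lebesgue_rV_opp//.
have E B : (fun x : 'rV[R]_n => x *m r%:M) @^-1` B = (fun x => r *: x) @^-1` B.
  by apply/funext => x; rewrite /= mul_mx_scalar.
rewrite !E (_ : _ @^-1` cube 1 = cube r^-1); last first.
  have E1 (x : 'rV[R]_n) i : (`|(r *: x) ord0 i| <= 1) = (`|x ord0 i| <= r^-1).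
    by rewrite mxE normrM (gtr0_norm r0) -[r^-1]mulr1 ler_pdivlMl.
  by apply/seteqP; split => x /= h i; have := h i; rewrite E1.
rewrite !lebesgue_rV_cube ?invr_ge0 ?(ltW r0)// muleC.
move=> /(congr1 (fun z => (((2 * 1) ^+ n)^-1%:E * z)%E)).
have c0 : (2 * 1 : R) ^+ n != 0 by rewrite expf_neq0// mulr1.
rewrite !muleA -!EFinM mulVf// mul1e => ->.
by congr (_%:E * _)%E; move: c0; rewrite mulr1 exprMn mulrA => c0; rewrite mulVf ?mul1r.
Qed.

Lemma lebesgue_rV_int_orthogonal (Q : 'M[R]_n) (f : 'rV[R]_n -> \bar R) :
  Q *m Q^T = 1%:M -> measurable_fun setT f -> (forall x, 0 <= f x)%E ->
  (\int[mu]_x f (x *m Q) = \int[mu]_x f x)%E.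
Proof.
move=> hQ mf f0.
transitivity (\int[pushforward mu (fun x => x *m Q)]_x f x)%E.
  by rewrite (ge0_integral_pushforward (measurable_rV_mul Q)).
apply: (eq_measure_integral (m1 := image_measure (measurable_rV_mul Q) mu)
  mu) => A mA _.
exact: lebesgue_rV_orthogonal.
Qed.

End invariance.

(** * Borel sets of row vectors *)

Section borel.
Context (R : realType) (n : nat).

Lemma mx_ballE (x y : 'rV[R]_n) e : 0 < e ->
  ball x e y <-> forall i, `|x ord0 i - y ord0 i| < e.
Proof.
move=> e0; split; first by case=> _ h i; have := h ord0 i; rewrite -ball_normE.
by move=> h; split => // i j; rewrite -ball_normE /= (ord1 i).
Qed.

(** An open set is the union of the balls of radius 1 / (k + 1) with rational
centre that it contains. *)
Lemma open_measurable_rV (U : set 'rV[R]_n) : open U -> measurable U.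
Proof.
move=> oU.
pose c (q : 'rV[rat]_n) : 'rV[R]_n := map_mx (@ratr R) q.
pose F (p : 'rV[rat]_n * nat) : set 'rV[R]_n :=
  if `[< ball (c p.1) p.2.+1%:R^-1 `<=` U >] then ball (c p.1) p.2.+1%:R^-1 else set0.
have -> : U = \bigcup_p F p.
  apply/seteqP; split; last first.
    by move=> x [p _]; rewrite /F; case: asboolP => // h /h.
  move=> x Ux; move: oU; rewrite openE => /(_ _ Ux) /nbhs_ballP[e /= e0 he].
  have [k hk] : exists k : nat, k.+1%:R^-1 < e / 2.
    have e20 : 0 < e / 2 by rewrite divr_gt0.
    exists (Num.bound (e / 2)^-1); rewrite invf_plt ?posrE//.
    apply: lt_le_trans (archi_boundP _) _; first by rewrite invr_ge0 ltW.
    by rewrite ler_nat.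
  have k0 : 0 < k.+1%:R^-1 :> R by [].
  have [d [dE d0]] : exists d : R, d = k.+1%:R^-1 /\ 0 < d by exists k.+1%:R^-1.
  have hq i : exists q : rat, `|ratr q - x ord0 i| < d.
    have : x ord0 i - d < x ord0 i + d by lra.
    move=> /rat_in_itvoo[q]; rewrite in_itv/= => /andP[h1 h2].
    by exists q; rewrite ltr_norml; apply/andP; split; lra.
  have [q hq'] := choice hq.
  exists (\row_i q i, k) => //; rewrite /F /= -dE; rewrite -dE in hk.
  case: asboolP => [_|[]].
    by apply/mx_ballE => // i; rewrite !mxE.
  move=> y /mx_ballE-/(_ d0) hy; apply: he; apply/mx_ballE => // i.
  have := hy i; have := hq' i; rewrite !mxE => h1 h2.
  have -> : x ord0 i - y ord0 i = - (ratr (q i) - x ord0 i) + (ratr (q i) - y ord0 i) by ring.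
  by apply: le_lt_trans (ler_normD _ _) _; rewrite normrN; lra.
apply: countable_bigcupT_measurable => // -[q k]; rewrite /F /=.
case: asboolP => // _.
have -> : ball (c q) k.+1%:R^-1 = \bigcap_(i in [set: 'I_n])
    ((fun x : 'rV[R]_n => x ord0 i) @^-1` ball (c q ord0 i) k.+1%:R^-1).
  apply/seteqP; split => x.
    by move=> /mx_ballE h i _; rewrite /= -ball_normE; exact: h.
  by move=> h; apply/mx_ballE => // i; have := h i I; rewrite /= -ball_normE.
apply: fin_bigcap_measurable => // i _.
apply: measurable_preimage (measurable_coord i) _.
exact: measurable_ball.
Qed.

Lemma closed_measurable_rV (C : set 'rV[R]_n) : closed C -> measurable C.
Proof.
move=> cC; rewrite -[C]setCK; apply: measurableC; apply: open_measurable_rV.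
exact: closed_openC.
Qed.

Lemma compact_measurable_rV (C : set 'rV[R]_n) : compact C -> measurable C.
Proof.
move=> cC; apply: closed_measurable_rV; exact: compact_closed.
Qed.

Lemma continuous_measurable_rV (f : 'rV[R]_n -> R) : continuous f ->
  measurable_fun setT f.
Proof.
move=> /continuousP cf; apply: (measurability _ (RGenOpens.measurableE R)).
move=> _ [_ [a [b ->] <-]].
rewrite setTI; apply: open_measurable_rV; exact/cf/interval_open.
Qed.

End borel.

(** * Averages over signs and Khintchine's inequality *)

Section sign_average.
Variable R : rcfType.

(** The mean of [F (z + sum_i eps_i x_i)] over independent signs eps_i.  The
recursion on the list with a free starting point z makes every identity below a
direct induction. *)
Fixpoint sign_avg (V : zmodType) (F : V -> R) (xs : seq V) (z : V) : R :=
  if xs is x :: xs' then (sign_avg F xs' (z + x) + sign_avg F xs' (z - x)) / 2 else F z.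

Lemma sign_avg_le (V : zmodType) (F G : V -> R) xs z :
  (forall y, F y <= G y) -> sign_avg F xs z <= sign_avg G xs z.
Proof.
move=> FG; elim: xs z => //= x xs IH z.
by rewrite ler_pM2r ?invr_gt0 ?ltr0n// lerD.
Qed.

Lemma sign_avg_ge0 (V : zmodType) (F : V -> R) xs z :
  (forall y, 0 <= F y) -> 0 <= sign_avg F xs z.
Proof. by move=> F0; elim: xs z => //= x xs IH z; rewrite divr_ge0// addr_ge0. Qed.

Lemma sign_avg_lin (V : zmodType) (F G : V -> R) (a b : R) xs z :
  sign_avg (fun y => a * F y + b * G y) xs z = a * sign_avg F xs z + b * sign_avg G xs z.
Proof. by elim: xs z => //= x xs IH z; rewrite !IH; field. Qed.

Lemma sign_avg_sqr (xs : seq R) z :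
  sign_avg (fun y => y ^+ 2) xs z = z ^+ 2 + \sum_(x <- xs) x ^+ 2.
Proof.
elim: xs z => [|x xs IH] z /=; first by rewrite big_nil addr0.
by rewrite !IH big_cons; field.
Qed.

Lemma sign_avg_expr4 (xs : seq R) z (s := \sum_(x <- xs) x ^+ 2) :
  sign_avg (fun y => y ^+ 4) xs z <= z ^+ 4 + 6 * z ^+ 2 * s + 3 * s ^+ 2.
Proof.
rewrite {}/s; elim: xs z => [|x xs IH] z /=; first by rewrite big_nil; lra.
rewrite big_cons.
have := lerD (IH (z + x)) (IH (z - x)); set s := \sum_(_ <- _) _.
rewrite -(ler_pM2r (x := 2^-1)) ?invr_gt0 ?ltr0n// => h; apply: le_trans h _.
have x4 : 0 <= x ^+ 4 by rewrite -[4%N]/(2 * 2)%N exprM sqr_ge0.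
set L := (X in X <= _); set RHS := (X in _ <= X).
suff -> : L = RHS - 2 * x ^+ 4 by lra.
by rewrite /L /RHS; field.
Qed.

(** Cauchy-Schwarz, by summing [|x| <= (a + x^2 / a) / 2] with the optimal a. *)
Lemma sum_norm_le (xs : seq R) (s := \sum_(x <- xs) x ^+ 2) :
  \sum_(x <- xs) `|x| <= Num.sqrt (size xs)%:R * Num.sqrt s.
Proof.
have amgm (a : R) : 0 < a ->
    \sum_(x <- xs) `|x| <= ((size xs)%:R * a + s / a) / 2.
  move=> a0; rewrite /s; elim: xs {s} => [|x xs IH].
    by rewrite !big_nil !mul0r addr0 mul0r.
  rewrite !big_cons /= -[(size xs).+1%:R]natr1; set S := \sum_(_ <- _) _ ^+ 2 in IH *.
  have : `|x| <= (a + x ^+ 2 / a) / 2.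
    have := sqr_ge0 (`|x| - a); rewrite sqrrB real_normK ?num_real// => h.
    rewrite -(ler_pM2r a0).
    have -> : (a + x ^+ 2 / a) / 2 * a = (a ^+ 2 + x ^+ 2) / 2 by field; lra.
    by lra.
  move: IH; rewrite !mulrDl mul1r; lra.
have s0 : 0 <= s by apply: sumr_ge0 => x _; rewrite sqr_ge0.
case: (posnP (size xs)) => [/size0nil xs0|n0].
  by rewrite /s xs0 !big_nil sqrtr0 mulr0.
have [s00|sn0] := eqVneq s 0.
  rewrite s00 sqrtr0 mulr0 big_seq big1// => x xxs; apply/eqP.
  rewrite normr_eq0 -(sqrf_eq0 x); move: s00 => /eqP; rewrite /s.
  rewrite psumr_eq0; last by move=> y _; exact: sqr_ge0.
  by move=> /allP/(_ _ xxs).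
have {}s0 : 0 < s by rewrite lt_def sn0.
set u := Num.sqrt s; set v := Num.sqrt _.
have u0 : 0 < u by rewrite sqrtr_gt0.
have v0 : 0 < v by rewrite sqrtr_gt0 ltr0n.
have := amgm (u / v) (divr_gt0 u0 v0).
have -> : (size xs)%:R = v ^+ 2 by rewrite sqr_sqrtr.
have -> : s = u ^+ 2 by rewrite sqr_sqrtr// ltW.
move=> h; apply: le_trans h _.
by rewrite le_eqVlt; apply/orP; left; apply/eqP; field; rewrite !gt_eqF.
Qed.

(** Let u be the square root of the sum of the squares.  The mean of the squares
is u^2 and the mean of the fourth powers is at most 3 u^4.  Taking means in the
pointwise inequality [|y| >= y^2 / u - (4 / 27) y^4 / u^3] bounds the mean absolute
value below by [(5 / 9) u >= u / 2], and [sum_norm_le] bounds the sum of the |x|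
by sqrt n times u. *)
Lemma khintchine (xs : seq R) :
  \sum_(x <- xs) `|x| <= 2 * Num.sqrt (size xs)%:R * sign_avg Num.norm xs 0.
Proof.
apply: le_trans (sum_norm_le xs) _.
set s : R := \sum_(_ <- _) _.
have s0 : 0 <= s by apply: sumr_ge0 => x _; rewrite sqr_ge0.
rewrite -mulrA mulrCA ler_wpM2l ?sqrtr_ge0//.
have [s00|sn0] := eqVneq s 0.
  rewrite s00 sqrtr0 mulr_ge0//.
  exact: sign_avg_ge0.
have {}s0 : 0 < s by rewrite lt_def sn0.
set u : R := Num.sqrt s.
have u0 : 0 < u by rewrite sqrtr_gt0.
have pt (y : R) : u^-1 * y ^+ 2 + (- (4 / 27) * u^-1 ^+ 3) * y ^+ 4 <= `|y|.
  have -> : y ^+ 2 = `|y| ^+ 2 by rewrite real_normK ?num_real.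
  have -> : y ^+ 4 = `|y| ^+ 4.
    by rewrite -[4%N]/(2 * 2)%N !exprM real_normK ?num_real.
  have : 0 <= `|y| by [].
  move: (`|y| : R) => {}y y0.
  have -> : u^-1 * y ^+ 2 + (- (4 / 27) * u^-1 ^+ 3) * y ^+ 4 =
     y * (1 - (1 - u^-1 * y + 4 / 27 * (u^-1 * y) ^+ 3)) by field; rewrite gt_eqF.
  rewrite -[leRHS]mulr1 ler_wpM2l// gerBl.
  have z0 : 0 <= u^-1 * y by rewrite mulr_ge0// invr_ge0 ltW.
  move: (u^-1 * y : R) z0 => z z0.
  (* 4 / 27 is chosen so that the cubic has a double root, at 3 / 2. *)
  have -> : 1 - z + 4 / 27 * z ^+ 3 = 4 / 27 * (z - 3 / 2) ^+ 2 * (z + 3) by field.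
  apply: mulr_ge0; last lra.
  by apply: mulr_ge0; [lra|exact: sqr_ge0].
have := sign_avg_le xs 0 pt; rewrite sign_avg_lin sign_avg_sqr expr0n/= add0r -/s.
have := sign_avg_expr4 xs 0; rewrite -/s !expr0n/= mulr0 mul0r !add0r.
have us : s = u ^+ 2 by rewrite sqr_sqrtr// ltW.
rewrite us; set E4 := sign_avg _ _ _; set E := sign_avg _ _ _ => h4.
have -> : u^-1 * u ^+ 2 = u by field; rewrite gt_eqF.
have c0 : 0 < 4 / 27 * u^-1 ^+ 3.
  by apply: mulr_gt0; [lra|rewrite exprn_gt0 ?invr_gt0].
move: h4; rewrite -(ler_pM2l c0 E4).
have -> : 4 / 27 * u^-1 ^+ 3 * (3 * (u ^+ 2) ^+ 2) = 4 / 9 * u by field; rewrite gt_eqF.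
by lra.
Qed.

End sign_average.

(** * Smoothing along finitely many translations

N is a seminorm on the subspace I of V, and T is an action of the group W on V by
linear maps that preserve I and N.  In the application V is a space of functions,
I the integrable ones, N the L1 norm and T the translations. *)

Section smoothing.
Variables (R : rcfType) (V : lmodType R) (W : zmodType).
Variables (I : V -> Prop) (N : V -> R) (T : W -> V -> V).
Hypothesis ID : forall f g, I f -> I g -> I (f + g).
Hypothesis IZ : forall c f, I f -> I (c *: f).
Hypothesis IT : forall v f, I f -> I (T v f).
Hypothesis ND : forall f g, I f -> I g -> N (f + g) <= N f + N g.
Hypothesis NZ : forall c f, I f -> N (c *: f) = `|c| * N f.
Hypothesis NT : forall v f, I f -> N (T v f) = N f.
Hypothesis TD : forall v f g, T v (f + g) = T v f + T v g.
Hypothesis TZ : forall v c f, T v (c *: f) = c *: T v f.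
Hypothesis TT : forall v w f, T (v + w) f = T v (T w f).
Hypothesis T0 : forall f, T 0 f = f.

Implicit Types (f g : V) (v w : W) (ws : seq W).

Definition diff v f := T v f - f.

Let IN f : I f -> I (- f). Proof. by move=> h; rewrite -scaleN1r; exact: IZ. Qed.
Let IB f g : I f -> I g -> I (f - g).
Proof. by move=> h1 h2; apply: ID => //; exact: IN. Qed.
Let Idiff v f : I f -> I (diff v f).
Proof. by move=> h; apply: IB => //; exact: IT. Qed.
Let NN f : I f -> N (- f) = N f.
Proof. by move=> h; rewrite -scaleN1r NZ// normrN1 mul1r. Qed.
Let NB f g : I f -> I g -> N (f - g) <= N f + N g.
Proof. by move=> h1 h2; rewrite -(NN h2); apply: ND => //; exact: IN. Qed.
Let TN v f : T v (- f) = - T v f.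
Proof. by rewrite -(scaleN1r f) -(scaleN1r (T v f)) TZ. Qed.
Let T0r v : T v 0 = 0.
Proof. by rewrite -(scale0r (0 : V)) TZ !scale0r. Qed.
Let TC v w f : T v (T w f) = T w (T v f).
Proof. by rewrite -!TT addrC. Qed.
Let I0 f : I f -> I 0. Proof. by move=> /(IZ 0); rewrite scale0r. Qed.
Let N0 f : I f -> N 0 = 0.
Proof. by move=> h; rewrite -(scale0r f) NZ// normr0 mul0r. Qed.

Definition modulus f v := N (diff v f).

Lemma N_ge0 f : I f -> 0 <= N f.
Proof.
move=> h; have := NB h h; rewrite subrr (N0 h); lra.
Qed.

Lemma diffD v f g : diff v (f + g) = diff v f + diff v g.
Proof. by rewrite /diff TD opprD addrACA. Qed.

Lemma diffN v f : diff v (- f) = - diff v f.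
Proof. by rewrite /diff TN opprB opprK addrC. Qed.

Lemma diffZ v c f : diff v (c *: f) = c *: diff v f.
Proof. by rewrite /diff TZ scalerBr. Qed.

Lemma diff_add v w f : diff (v + w) f = T v (diff w f) + diff v f.
Proof. by rewrite /diff TT TD TN addrA subrK. Qed.

Lemma diff_opp w f : diff (- w) f = - T (- w) (diff w f).
Proof. by rewrite /diff TD TN -TT addNr T0 opprB. Qed.

Lemma N_diff_opp w f : I f -> N (diff (- w) f) = N (diff w f).
Proof.
by move=> h; rewrite diff_opp NN; [rewrite NT//; exact: Idiff|apply: IT; exact: Idiff].
Qed.

Lemma N_diff_add v w f : I f -> N (diff (v + w) f) <= N (diff v f) + N (diff w f).
Proof.
move=> h; rewrite diff_add [leRHS]addrC.
have hw := Idiff w h.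
by rewrite -(NT v hw); apply: ND; [exact: IT|exact: Idiff].
Qed.

Lemma N_diff_le v f : I f -> N (diff v f) <= 2 * N f.
Proof. by move=> h; have := NB (IT v h) h; rewrite NT// /diff; lra. Qed.

Lemma N_diff_mul w k f : I f -> N (diff (w *+ k) f) <= k%:R * N (diff w f).
Proof.
move=> h; elim: k => [|k IH].
  by rewrite mulr0n /diff T0 subrr (N0 h) mul0r.
rewrite mulrS; apply: le_trans (N_diff_add _ _ h) _.
by rewrite -natr1 mulrDl mul1r addrC lerD2r.
Qed.

Variables (m : nat).
Hypothesis m_gt0 : (0 < m)%N.

(** The mean of f over the first m multiples of the translation w; [smooth] composes
these means over the list ws, which is the mean over a discrete box. *)
Definition avg w f := m%:R^-1 *: \sum_(k < m) T (w *+ k) f.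
Definition smooth ws f := foldr avg f ws.

Let mr0 : 0 < m%:R :> R. Proof. by rewrite ltr0n. Qed.

Let Isum n (F : 'I_n -> V) f : I f -> (forall k, I (F k)) -> I (\sum_k F k).
Proof. by move=> If hF; elim/big_ind : _ => //; exact: I0 If. Qed.

Let Nsum n (F : 'I_n -> V) f (c : R) : I f -> (forall k, I (F k)) ->
  (forall k, N (F k) <= c) -> N (\sum_k F k) <= n%:R * c.
Proof.
move=> If hF hc.
have : I (\sum_k F k) /\ N (\sum_k F k) <= \sum_(k < n) c.
  elim/big_ind2 : _ => //; first by split; [exact: I0 If|rewrite (N0 If)].
  move=> a b a' b' [Ia Na] [Ia' Na']; split; first exact: ID.
  by apply: le_trans (ND Ia Ia') _; exact: lerD.
by rewrite sumr_const card_ord mulr_natl => -[].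
Qed.

Let Iavg w f : I f -> I (avg w f).
Proof. by move=> h; apply: IZ; apply: (Isum h) => k; exact: IT. Qed.

Let Ismooth ws f : I f -> I (smooth ws f).
Proof. by move=> h; elim: ws => //= w ws IH; exact: Iavg. Qed.

Lemma N_avg w f : I f -> N (avg w f) <= N f.
Proof.
move=> h; rewrite NZ; last by apply: (Isum h) => k; exact: IT.
rewrite ger0_norm ?invr_ge0// mulrC ler_pdivrMr// mulrC.
by apply: (Nsum h) => k; [exact: IT|rewrite NT].
Qed.

Lemma N_smooth ws f : I f -> N (smooth ws f) <= N f.
Proof.
move=> h; elim: ws => //= w ws IH; apply: le_trans IH.
by apply: N_avg; exact: Ismooth.
Qed.

Lemma diff_avg v w f : diff v (avg w f) = avg w (diff v f).
Proof.
rewrite /avg diffZ; congr (_ *: _).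
rewrite /diff (big_morph (T v) (id1 := 0) (op1 := +%R)); last 2 first.
- by move=> f1 f2; exact: TD.
- exact: T0r.
rewrite -sumrB; apply: eq_bigr => k _.
by rewrite TD TN TC.
Qed.

Lemma diff_smooth v ws f : diff v (smooth ws f) = smooth ws (diff v f).
Proof. by elim: ws => //= w ws IH; rewrite diff_avg IH. Qed.

(** The sum over the multiples of w telescopes. *)
Lemma diff_avg_self w f : diff w (avg w f) = m%:R^-1 *: diff (w *+ m) f.
Proof.
rewrite /avg diffZ; congr (_ *: _).
elim: (m) => [|k IH].
  by rewrite big_ord0 mulr0n /diff T0r T0 !subrr.
rewrite big_ord_recr /= diffD IH /diff -TT -mulrS.
by rewrite addrC addrA subrK.
Qed.

(** The gain from smoothing: telescoping in the direction w of the box leaves a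
factor 1 / m. *)
Lemma N_diff_smooth w ws f : I f -> w \in ws ->
  N (diff w (smooth ws f)) <= 2 / m%:R * N f.
Proof.
move=> h; elim: ws => //= w' ws IH; rewrite inE.
have [<- _|_ /= /IH hw] := eqVneq w w'.
  have h' := Ismooth ws h.
  rewrite diff_avg_self NZ; last exact: Idiff.
  rewrite ger0_norm ?invr_ge0// mulrAC ler_pdivlMr// mulrAC mulVf ?gt_eqF// mul1r.
  apply: le_trans (N_diff_le _ h') _.
  by rewrite ler_pM2l// N_smooth.
by rewrite diff_avg; apply: le_trans hw; apply: N_avg; apply: Idiff; exact: Ismooth.
Qed.

Lemma N_avg_sub w f : I f -> N (avg w f - f) <= m%:R * N (diff w f).
Proof.
move=> h.
have -> : avg w f - f = m%:R^-1 *: \sum_(k < m) diff (w *+ k) f.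
  rewrite /diff sumrB scalerBr sumr_const card_ord.
  rewrite -[f *+ m]scaler_nat scalerA.
  by rewrite mulVf ?gt_eqF// scale1r.
rewrite NZ; last by apply: (Isum h) => k; exact: Idiff.
rewrite ger0_norm ?invr_ge0// mulrC ler_pdivrMr// mulrC.
apply: (Nsum h) => k; first exact: Idiff.
apply: le_trans (N_diff_mul _ _ h) _.
by rewrite ler_wpM2r ?N_ge0 ?ler_nat 1?ltnW//; exact: Idiff.
Qed.

Lemma N_smooth_sub ws f : I f ->
  N (smooth ws f - f) <= m%:R * \sum_(w <- ws) N (diff w f).
Proof.
move=> h; elim: ws => [|w ws IH] /=.
  by rewrite subrr big_nil mulr0 (N0 h).
rewrite big_cons mulrDr.
have -> : avg w (smooth ws f) - f = (avg w f - f) + avg w (smooth ws f - f).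
  have -> : avg w (smooth ws f - f) = avg w (smooth ws f) - avg w f.
    rewrite /avg -scalerBr -sumrB; congr (_ *: _); apply: eq_bigr => k _.
    by rewrite TD TN.
  by rewrite [RHS]addrC addrA subrK.
have hs := Ismooth ws h.
apply: le_trans (ND _ _) _; [by apply: IB => //; exact: Iavg|by apply: Iavg; exact: IB|].
apply: lerD; first exact: N_avg_sub.
by apply: le_trans IH; apply: N_avg; exact: IB.
Qed.

Lemma sign_avg_lip fs g g' : I g -> I g' -> (forall f, f \in fs -> I f) ->
  sign_avg N fs g <= sign_avg N fs g' + N (g - g').
Proof.
elim: fs g g' => [|f fs IH] g g' hg hg' hfs /=.
  by rewrite -[X in N X <= _](subrK g') addrC; apply: ND => //; exact: IB.
have hf : I f by apply: hfs; rewrite mem_head.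
have hfs' f' : f' \in fs -> I f' by move=> ?; apply: hfs; rewrite inE orbC; apply/orP; left.
have := IH (g + f) (g' + f) (ID hg hf) (ID hg' hf) hfs'.
have := IH (g - f) (g' - f) (IB hg hf) (IB hg' hf) hfs'.
rewrite (_ : g - f - (g' - f) = g - g'); last by rewrite opprB addrA subrK.
rewrite (_ : g + f - (g' + f) = g - g'); last by rewrite opprD addrACA subrr addr0.
lra.
Qed.

(** Approximate linearity in the mean of [v |-> diff v G], where G is the smoothed f.
Adding one vector at a time, [diff (v + w) G - diff v G - diff w G] is the second
difference [diff w (diff v G)], which is small by [N_diff_smooth] because differences
commute with smoothing; for v - w there is one more term, the second difference
in - w and w. *)
Lemma sign_avg_smooth (ws r : seq W) f v : I f -> {subset r <= ws} ->
  sign_avg N [seq diff w (smooth ws f) | w <- r] (diff v (smooth ws f)) <=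
  sign_avg (modulus f) r v + (size r)%:R * (2 / m%:R) *
    (modulus f v + \sum_(w <- r) modulus f w).
Proof.
move=> h; set G := smooth ws f; set q := modulus f.
have hG : I G by exact: Ismooth.
elim: r v => [|w r IH] v hr.
  by rewrite /= !mul0r addr0 /G diff_smooth; apply: N_smooth; exact: Idiff.
have wws : w \in ws by apply: hr; rewrite mem_head.
have hr' : {subset r <= ws} by move=> x xr; apply: hr; rewrite inE xr orbT.
have Ir f' : f' \in [seq diff w (smooth ws f) | w <- r] -> I f'.
  by move=> /mapP[w' _ ->]; exact: Idiff.
have q0 u : 0 <= q u by apply: N_ge0; exact: Idiff.
have c0 : 0 <= 2 / m%:R :> R by rewrite divr_ge0.
have small u : N (diff w (diff u G)) <= 2 / m%:R * q u.
  by rewrite /G [diff u _]diff_smooth; apply: N_diff_smooth => //; exact: Idiff.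
have e1 : N (diff v G + diff w G - diff (v + w) G) <= 2 / m%:R * q v.
  rewrite (_ : _ - _ = - diff w (diff v G)); last first.
    rewrite [v + w]addrC diff_add opprD addrACA subrr addr0.
    by rewrite [in RHS]/diff opprB.
  by rewrite NN; [exact: small|exact/Idiff/Idiff].
have e2 : N (diff v G - diff w G - diff (v - w) G) <= 2 / m%:R * (q v + q w).
  rewrite (_ : _ - _ = - diff (- w) (diff v G) + diff (- w) (diff w G)); last first.
    have dN g : diff (- w) g = T (- w) g - g by [].
    rewrite [v - w]addrC diff_add [diff (- w) G]diff_opp.
    rewrite !dN.
    set a := T _ (diff v G); set b := T _ (diff w G).
    by rewrite !opprB addrACA [RHS]addrACA [X in _ = _ + X]addrC.
  apply: le_trans (ND _ _) _; [exact/IN/Idiff/Idiff|exact/Idiff/Idiff|].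
  rewrite NN; last exact/Idiff/Idiff.
  rewrite !N_diff_opp; [|exact: Idiff..].
  by rewrite mulrDr lerD.
have L1 := sign_avg_lip (ID (Idiff v hG) (Idiff w hG)) (Idiff (v + w) hG) Ir.
have L2 := sign_avg_lip (IB (Idiff v hG) (Idiff w hG)) (Idiff (v - w) hG) Ir.
have := IH (v + w) hr'; have := IH (v - w) hr'.
have s1 : q (v + w) <= q v + q w by exact: N_diff_add.
have s2 : q (v - w) <= q v + q w by rewrite /q /modulus -(N_diff_opp w h); exact: N_diff_add.
rewrite /= big_cons.
set S := \sum_(_ <- _) _; set d := 2 / m%:R in c0 small e1 e2 *.
have S0 : 0 <= S by apply: sumr_ge0 => u _.
move=> h2 h1.
have k0 : 0 <= (size r)%:R * d by rewrite mulr_ge0.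
have t1 : (size r)%:R * d * (q (v + w) + S) <= (size r)%:R * d * (q v + (q w + S)).
  by rewrite ler_wpM2l//; lra.
have t2 : (size r)%:R * d * (q (v - w) + S) <= (size r)%:R * d * (q v + (q w + S)).
  by rewrite ler_wpM2l//; lra.
have t3 : d * q v <= d * (q v + (q w + S)) by rewrite ler_wpM2l//; have := q0 w; lra.
have t4 : d * (q v + q w) <= d * (q v + (q w + S)) by rewrite ler_wpM2l//; lra.
rewrite -[(size r).+1%:R]natr1 [(_ + 1) * d]mulrDl mul1r [(_ + d) * _]mulrDl.
lra.
Qed.

(** If N satisfies Khintchine's inequality with constant kappa, then the modulus
satisfies it up to two errors.  The first is the failure of linearity
[sign_avg_smooth], of relative order 1 / m.  The second comes from replacing f by the
smoothed f on the left: it is at most m times the moduli of the small translations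
w, and is compared with translations w *+ M, so it is of relative order m / M. *)
Lemma smoothing_transfer (ws : seq W) f M (kappa : R) : I f -> 0 <= kappa ->
  (forall fs, size fs = size ws -> (forall g, g \in fs -> I g) ->
    kappa * \sum_(g <- fs) N g <= sign_avg N fs 0) ->
  kappa * \sum_(w <- ws) modulus f (w *+ M) <=
  M%:R * (sign_avg (modulus f) ws 0 +
    (size ws)%:R * (2 / m%:R) * \sum_(w <- ws) modulus f w)
  + 2 * kappa * (size ws)%:R * m%:R * \sum_(w <- ws) modulus f w.
Proof.
move=> h kappa0 HK; set q := modulus f; set Q := \sum_(w <- ws) q w; set G := smooth ws f.
have hG : I G by exact: Ismooth.
have K1 := HK [seq diff w G | w <- ws].
have {}K1 : kappa * \sum_(w <- ws) N (diff w G) <= sign_avg N [seq diff w G | w <- ws] 0.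
  rewrite -(big_map (fun w => diff w G) xpredT N).
  by apply: K1; [rewrite size_map|move=> g /mapP[w _ ->]; exact: Idiff].
have K2 := @sign_avg_smooth ws ws f 0 h (fun _ => id).
rewrite /= -/G in K2.
have D0 g : diff 0 g = 0 by rewrite /diff T0 subrr.
rewrite !D0 -/q -/Q {2}/q /modulus D0 (N0 h) add0r in K2.
have K3 w : q (w *+ M) <= M%:R * N (diff w G) + 2 * (m%:R * Q).
  rewrite {1}/q /modulus {1}(_ : f = G - (G - f)); last by rewrite opprB addrC subrK.
  have hB : I (G - f) by exact: IB.
  rewrite diffD diffN; apply: le_trans (NB _ _) _; [exact: Idiff|exact: Idiff|].
  apply: lerD; first exact: N_diff_mul.
  apply: le_trans (N_diff_le _ hB) _; rewrite ler_pM2l//.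
  exact: N_smooth_sub.
have K4 : \sum_(w <- ws) q (w *+ M) <=
    M%:R * \sum_(w <- ws) N (diff w G) + (size ws)%:R * (2 * (m%:R * Q)).
  elim: (ws) => [|w r IH]; first by rewrite !big_nil mulr0 mul0r addr0.
  rewrite !big_cons /= -[(size r).+1%:R]natr1 mulrDr mulrDl mul1r.
  by have := K3 w; lra.
have := ler_wpM2l kappa0 K4.
have M0 : 0 <= M%:R :> R by [].
have := ler_wpM2l M0 (le_trans K1 K2).
set A := \sum_(w <- ws) N (diff w G); set B := sign_avg q ws 0.
rewrite !mulrDr; lra.
Qed.

End smoothing.

(** * The L1 modulus of translation *)

Section L1_modulus.
Context (R : realType) (n : nat).
Local Notation mu := (lebesgue_rV R n).
Implicit Types (f g : 'rV[R]_n -> R) (v w : 'rV[R]_n).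

Definition L1 f := mu.-integrable [set: 'rV[R]_n] (EFin \o f).
Definition norm1 f : R := \int[mu]_x `|f x|.
Definition shift v f : 'rV[R]_n -> R := fun x => f (x + v).

Lemma L1D f g : L1 f -> L1 g -> L1 (f + g).
Proof.
move=> hf hg; have := integrableD measurableT hf hg.
by apply: eq_integrable.
Qed.

Lemma L1Z c f : L1 f -> L1 (c *: f).
Proof.
move=> hf; have := integrableZl measurableT c hf.
by apply: eq_integrable.
Qed.

Lemma L1_norm f : L1 f -> L1 (fun x => `|f x|).
Proof. by move=> hf; have := integrable_norm hf. Qed.

Lemma L1_measurable f : L1 f -> measurable_fun setT f.
Proof. by case/integrableP => /measurable_EFinP. Qed.

Lemma L1_shift v f : L1 f -> L1 (shift v f).
Proof.
move=> hf; have mf := L1_measurable hf.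
have mv : measurable_fun setT (shift v f).
  exact: measurableT_comp mf (measurable_rV_shift v).
apply/integrableP; split; first exact/measurable_EFinP.
have /integrableP[_] := hf.
rewrite -(lebesgue_rV_int_translate v (f := fun x => `|(f x)%:E|%E))//.
by apply: measurableT_comp => //; exact/measurable_EFinP.
Qed.

Lemma norm1_shift v f : L1 f -> norm1 (shift v f) = norm1 f.
Proof.
move=> hf; rewrite /norm1 /Rintegral; congr fine.
rewrite -(lebesgue_rV_int_translate v (f := fun x => `|f x|%:E))//.
by apply/measurable_EFinP; apply: measurableT_comp => //; exact: L1_measurable.
Qed.

Lemma norm1D f g : L1 f -> L1 g -> norm1 (f + g) <= norm1 f + norm1 g.
Proof.
move=> hf hg; rewrite /norm1 -RintegralD//; [|exact: L1_norm..].
apply: le_Rintegral => //.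
- exact/L1_norm/L1D.
- exact: L1D (L1_norm hf) (L1_norm hg).
- by move=> x _; exact: ler_normD.
Qed.

Lemma norm1Z c f : L1 f -> norm1 (c *: f) = `|c| * norm1 f.
Proof.
move=> hf; rewrite /norm1 -RintegralZl//; last exact: L1_norm.
by apply: eq_Rintegral => x _; rewrite normrM.
Qed.

Lemma sign_avg_Rintegral (fs : seq ('rV[R]_n -> R)) g : L1 g ->
  (forall f, f \in fs -> L1 f) ->
  L1 (fun x => sign_avg Num.norm [seq f x | f : _ -> R <- fs] (g x)) /\
  sign_avg norm1 fs g = \int[mu]_x sign_avg Num.norm [seq f x | f : _ -> R <- fs] (g x).
Proof.
elim: fs g => [|f fs IH] g hg hfs /=; first by split => //; exact: L1_norm.
have hf : L1 f by apply: hfs; rewrite mem_head.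
have hfs' f' : f' \in fs -> L1 f' by move=> ?; apply: hfs; rewrite inE orbC; apply/orP; left.
have [h1 e1] := IH _ (L1D hg hf) hfs'.
have [h2 e2] := IH _ (L1D hg (L1Z (-1) hf)) hfs'.
have gE x : (g + -1 *: f) x = g x - f x by rewrite scaleN1r.
have E x : (sign_avg Num.norm [seq f x | f : _ -> R <- fs] (g x + f x) +
   sign_avg Num.norm [seq f x | f : _ -> R <- fs] (g x - f x)) / 2 =
   (2^-1 *: ((fun x => sign_avg Num.norm [seq f x | f : _ -> R <- fs] ((g + f) x)) +
   (fun x => sign_avg Num.norm [seq f x | f : _ -> R <- fs] ((g + -1 *: f) x)))) x.
  by rewrite -gE; exact: mulrC.
have h12 := L1D h1 h2.
split.
  rewrite (funext E).
  exact: L1Z.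
rewrite (eq_Rintegral _ (fun x _ => E x)).
rewrite RintegralZl// RintegralD//.
by rewrite e1 (_ : g - f = g + -1 *: f) ?scaleN1r// -scaleN1r e2 mulrC.
Qed.

(** Khintchine's inequality holds in L1 because it holds at every point. *)
Lemma khintchine_norm1 (fs : seq ('rV[R]_n -> R)) k : size fs = k ->
  (forall f, f \in fs -> L1 f) ->
  (2 * Num.sqrt k%:R)^-1 * \sum_(f <- fs) norm1 f <= sign_avg norm1 fs 0.
Proof.
move=> <- hfs; have L10 : L1 0 by exact: integrable0.
have [hL ->] := sign_avg_Rintegral L10 hfs.
have [hS ->] : L1 (fun x => \sum_(f <- fs) `|f x|) /\
    \sum_(f <- fs) norm1 f = \int[mu]_x \sum_(f <- fs) `|f x|.
  elim: fs hfs {hL} => [|f fs IH] hfs.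
    rewrite big_nil; split.
      by under eq_fun do rewrite big_nil; exact: integrable0.
    by under eq_Rintegral do rewrite big_nil; rewrite /Rintegral integral0.
  have hf : L1 f by apply: hfs; rewrite mem_head.
  have [h1 h2] := IH (fun f' h => hfs f' (mem_behead (s := f :: fs) h)).
  have nf := L1_norm hf.
  rewrite big_cons h2; split.
    under eq_fun do rewrite big_cons.
    exact: L1D nf h1.
  under [RHS]eq_Rintegral do rewrite big_cons.
  by rewrite RintegralD.
rewrite -RintegralZl//; apply: le_Rintegral => //.
  exact: L1Z hS.
move=> x _ /=.
have [s0|s0] := leP (2 * Num.sqrt (size fs)%:R : R) 0.
  have -> : (2 * Num.sqrt (size fs)%:R : R) = 0.
    by apply/eqP; rewrite eq_le s0 mulr_ge0// sqrtr_ge0.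
  rewrite invr0 mul0r.
  exact: sign_avg_ge0.
rewrite mulrC ler_pdivrMr// mulrC.
have := khintchine [seq f x | f : _ -> R <- fs].
by rewrite size_map big_map.
Qed.

Lemma ler_of_div_nat (a b c : R) :
  (forall m : nat, (0 < m)%N -> a <= b + c / m%:R) -> a <= b.
Proof.
move=> h; rewrite leNgt; apply/negP => ba.
have e0 : 0 < a - b by rewrite subr_gt0.
have := h (Num.bound (`|c| / (a - b))).+1 isT.
have : `|c| / (a - b) < (Num.bound (`|c| / (a - b))).+1%:R.
  apply: lt_trans (archi_boundP _) _; first by rewrite divr_ge0// ltW.
  by rewrite ltr_nat.
move: (Num.bound _).+1 (ltr0Sn R (Num.bound (`|c| / (a - b)))) => k k0.
rewrite ltr_pdivrMr// => h1 h2.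
move: h2; rewrite -(ler_pM2r k0) mulrDl mulfVK ?gt_eqF// => h2.
by have := ler_norm c; lra.
Qed.

Definition shift_modulus f v := norm1 (fun x => f (x + v) - f x).

Lemma sign_avg_scale (H : 'rV[R]_n -> R) (t : R) ws v :
  (forall w, H (t *: w) = t * H w) ->
  sign_avg H [seq t *: w | w <- ws] (t *: v) = t * sign_avg H ws v.
Proof.
move=> hH; elim: ws v => //= w ws IH v.
by rewrite -!(scalerDr, scalerBr) !IH; field.
Qed.

(** Khintchine's inequality for a homogeneous majorant H of the modulus of f, with
no error: [smoothing_transfer] is applied to the translations [t *: w] with
[t = b / m ^ 2] and [M = m ^ 2], so that both errors are O(1 / m), and m tends to
infinity.  The modulus at the scale b is kept on the left, since only a lower bound
at small scales will be known for it. *)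
Lemma shift_modulus_transfer f (H : 'rV[R]_n -> R) (ws : seq 'rV[R]_n) (b : R) :
  L1 f -> (forall v, shift_modulus f v <= H v) ->
  (forall t v, 0 < t -> H (t *: v) = t * H v) -> 0 < b ->
  (2 * Num.sqrt (size ws)%:R)^-1 * \sum_(w <- ws) shift_modulus f (b *: w) <=
  b * sign_avg H ws 0.
Proof.
move=> hf qH hH b0; set kappa := _^-1; set N := (size ws)%:R : R.
have k0 : 0 <= kappa by rewrite invr_ge0 mulr_ge0// sqrtr_ge0.
set S := \sum_(w <- ws) H w.
pose C := 2 * N * b * S + 2 * kappa * N * b * S.
apply: (@ler_of_div_nat _ _ C) => m m0.
have mr0 : 0 < m%:R :> R by rewrite ltr0n.
pose M := (m * m)%N.
have M0 : 0 < M%:R :> R by rewrite ltr0n muln_gt0 m0.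
pose t := b / M%:R; have t0 : 0 < t by rewrite divr_gt0.
have := @smoothing_transfer R _ _ L1 norm1 shift L1D L1Z L1_shift norm1D norm1Z
  norm1_shift (fun _ _ _ => erefl) (fun _ _ _ => erefl) _ _ m m0
  [seq t *: w | w <- ws] f M kappa hf k0 _.
have TT v w g : shift (v + w) g = shift v (shift w g).
  by apply/funext => x; rewrite /shift addrA.
have T0 g : shift 0 g = g by apply/funext => x; rewrite /shift addr0.
move=> /(_ TT T0).
rewrite size_map => /(_ (@khintchine_norm1 ^~ _)).
have bE w : t *: w *+ M = b *: w.
  by rewrite -scaler_nat scalerA /t mulrC divfK// gt_eqF.
rewrite !big_map; under eq_bigr do rewrite bE.
move=> h; apply: le_trans h _.
set A := sign_avg _ _ _; set Q := \sum_(j <- ws) _.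
have AE : A <= t * sign_avg H ws 0.
  rewrite -(sign_avg_scale _ _ (fun w => hH t w t0)) scaler0.
  exact: sign_avg_le.
have QS : Q <= t * S.
  rewrite /S mulr_sumr; apply: ler_sum => w _.
  by rewrite -hH//; exact: qH.
have h1 : M%:R * A <= b * sign_avg H ws 0.
  have -> : b = M%:R * t by rewrite /t mulrC divfK// gt_eqF.
  by rewrite -mulrA ler_pM2l.
have h2 : M%:R * (N * (2 / m%:R) * Q) <= 2 * N * b * S / m%:R.
  have -> : 2 * N * b * S / m%:R = M%:R * (N * (2 / m%:R) * (t * S)).
    by rewrite /t; field; rewrite !gt_eqF.
  rewrite ler_pM2l// ler_wpM2l// mulr_ge0// ?divr_ge0//; exact: ler0n.
have h3 : 2 * kappa * N * m%:R * Q <= 2 * kappa * N * b * S / m%:R.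
  have -> : 2 * kappa * N * b * S / m%:R = 2 * kappa * N * m%:R * (t * S).
    by rewrite /t /M natrM; field; rewrite !gt_eqF.
  by rewrite ler_wpM2l// !mulr_ge0// ?ler0n.
rewrite /C mulrDl mulrDr -/N; lra.
Qed.

End L1_modulus.

(** * Slicing by parallel lines *)

Section lines.
Context (R : realType) (m : nat).
Local Notation mu := (lebesgue_rV R).

Let mcons : measurable_fun [set: measurableTypeR R * 'rV[R]_m]
  (@cons_rV R m : measurableTypeR R * 'rV[R]_m -> 'rV[R]_m.+1).
Proof. exact: measurable_cons_rV. Qed.

Lemma lebesgue_rV_int_cons (g : 'rV[R]_m.+1 -> \bar R) :
  measurable_fun setT g -> (forall x, 0 <= g x)%E ->
  (\int[mu m.+1]_x g x = \int[mu m]_y \int[@lebesgue_measure R]_s g (cons_rV (s, y)))%E.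
Proof.
move=> mg g0.
rewrite (@eq_measure_integral _ _ _ [set: 'rV[R]_m.+1]
  (image_measure mcons (@lebesgue_measure R \x mu m)%E))//.
rewrite (ge0_integral_pushforward mcons)//.
rewrite -(fubini_tonelli2 (fun p : measurableTypeR R * 'rV[R]_m => g (cons_rV p)))//.
exact: measurableT_comp mg mcons.
Qed.

Lemma cons_rV_row_mx (s : R) (y : 'rV[R]_m) : cons_rV (s, y) = row_mx s%:M y.
Proof.
apply/rowP => i; rewrite mxE; case: (unliftP ord0 i) => [j ->|->] /=.
  rewrite -(row_mxEr (s%:M : 'M[R]_1) y ord0 j).
  by congr (row_mx _ _ _ _); exact: val_inj.
transitivity (row_mx (s%:M : 'M[R]_1) y ord0 (lshift m ord0)).
  by rewrite row_mxEl mxE mulr1n.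
by congr (row_mx _ _ _ _); exact: val_inj.
Qed.

Section frame.
Variables (u : 'rV[R]_m.+1) (F : 'M[R]_(m, m.+1)).
Hypotheses (u1 : norm2 u = 1) (FF : F *m F^T = 1%:M) (Fu : F *m u^T = 0).

(** An orthogonal matrix whose first row is u; in the coordinates that it defines,
the lines in direction u are the sets [y = constant]. *)
Definition frame : 'M[R]_m.+1 := col_mx u F.

Lemma cons_frame s y : cons_rV (s, y) *m frame = s *: u + y *m F.
Proof.
rewrite cons_rV_row_mx; apply: etrans (mul_row_col (s%:M : 'M[R]_1) y u F) _.
by rewrite mul_scalar_mx.
Qed.

Lemma frame_orthogonal : frame *m frame^T = 1%:M.
Proof.
have uu : u *m u^T = 1%:M.
  by apply/rowP => i; rewrite !ord1 -dotpE mxE eqxx; apply/norm2_eq1.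
have uF : u *m F^T = 0 by rewrite -[u]trmxK -trmx_mul Fu trmx0.
apply: etrans (congr1 (mulmx frame) (tr_col_mx u F)) _.
apply: etrans (mul_col_row u F u^T F^T) _.
by rewrite uu uF FF Fu -scalar_mx_block.
Qed.

Lemma frame_decomp (x : 'rV[R]_m.+1) : x = dotp x u *: u + (x *m F^T) *m F.
Proof.
rewrite -cons_frame cons_rV_row_mx.
have -> : (dotp x u)%:M = x *m u^T.
  by apply/rowP => i; rewrite !ord1 mxE eqxx mulr1n dotpE.
have -> : row_mx (x *m u^T) (x *m F^T) = x *m frame^T.
  apply: etrans (esym (mul_mx_row x u^T F^T)) _.
  by congr (_ *m _); exact: esym (tr_col_mx u F).
by rewrite -mulmxA (mulmx1C frame_orthogonal) mulmx1.
Qed.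

Lemma dotp_line s y : dotp (s *: u + y *m F) u = s.
Proof.
rewrite dotpDl dotpZl (norm2_eq1 u).1// mulr1 dotpE -mulmxA Fu mulmx0 mxE.
by rewrite addr0.
Qed.

Lemma lebesgue_rV_int_lines (g : 'rV[R]_m.+1 -> \bar R) :
  measurable_fun setT g -> (forall x, 0 <= g x)%E ->
  (\int[mu m.+1]_x g x =
   \int[mu m]_y \int[@lebesgue_measure R]_s g (s *: u + y *m F)%R)%E.
Proof.
move=> mg g0; rewrite -(lebesgue_rV_int_orthogonal frame_orthogonal)//.
rewrite (lebesgue_rV_int_cons (g := fun x => g (x *m frame))).
- apply: eq_integral => y _; apply: eq_integral => s _.
  by rewrite cons_frame.
- exact: measurableT_comp mg (measurable_rV_mul frame).
- by move=> x; exact: g0.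
Qed.

Lemma measurable_int_lines (g : 'rV[R]_m.+1 -> \bar R) :
  measurable_fun setT g -> (forall x, 0 <= g x)%E ->
  measurable_fun setT (fun y : 'rV[R]_m =>
    \int[@lebesgue_measure R]_s g (s *: u + y *m F)%R)%E.
Proof.
move=> mg g0.
pose G (p : measurableTypeR R * 'rV[R]_m) := g (cons_rV p *m frame).
have -> : (fun y : 'rV[R]_m => \int[@lebesgue_measure R]_s g (s *: u + y *m F)%R)%E =
    fubini_G (@lebesgue_measure R) G.
  by apply/funext => y; apply: eq_integral => s _; rewrite /G cons_frame.
apply: measurable_fun_fubini_tonelli_G => [|p]; last exact: g0.
apply: measurableT_comp mg _.
exact: measurableT_comp (measurable_rV_mul frame) mcons.
Qed.

(** The orthogonal projection of x is the point where the line through x in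
direction u meets the hyperplane. *)
Lemma proj_lines K : [set y | proj_hyperplane u K (y *m F)] =
  [set y | exists s, K (s *: u + y *m F)].
Proof.
apply/seteqP; split => y /=.
  by move=> [x Kx xE]; exists (dotp x u); rewrite -xE addrC subrK.
move=> [s Ks]; exists (s *: u + y *m F) => //.
by rewrite dotp_line addrAC subrr add0r.
Qed.

Lemma proj_image K : [set y | exists s, K (s *: u + y *m F)] =
  (fun x => x *m F^T) @` K.
Proof.
apply/seteqP; split => y /=.
  move=> [s Ks]; exists (s *: u + y *m F) => //.
  rewrite mulmxDl -mulmxA FF mulmx1 -scalemxAl -[u]trmxK -trmx_mul Fu.
  by rewrite trmx0 scaler0 add0r.
by move=> [x Kx <-]; exists (dotp x u); rewrite -frame_decomp.
Qed.

End frame.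
End lines.

(** * Translating a segment *)

Section one_dimensional.
Context (R : realType).
Local Notation leb := (@lebesgue_measure R).
Implicit Type I : set R.

Definition jump I (b : R) (s : R) : \bar R := `|\1_I (s + b) - \1_I s|%:E.

Lemma jump0 b s : jump set0 b s = 0%E.
Proof. by rewrite /jump !indicE !in_set0 subrr normr0. Qed.

Variables (I : set R) (b : R).
Hypotheses (b0 : 0 < b) (itvI : is_interval I).

Let mI : measurable I. Proof. exact: is_interval_measurable. Qed.

Let mjump : measurable_fun setT (jump I b).
Proof.
apply/measurable_EFinP; apply: measurableT_comp => //.
apply: measurable_funB; last exact: measurable_indic.
by apply: measurableT_comp (measurable_indic mI) _; exact: measurable_funD.
Qed.

Variables a c : R.
Hypotheses (Iin : forall x : R, I x -> a <= x <= c).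
Hypotheses (inI : forall x : R, a < x -> x < c -> I x).

Let jump_le (s : R) :
  (jump I b s <= (\1_`[(a - b)%R, a] s)%:E + (\1_`[(c - b)%R, c] s)%:E)%E.
Proof.
have b0' := b0; rewrite /jump -EFinD lee_fin !indicE.
have h x : x \in `[a - b, a]%classic = (a - b <= x <= a).
  by rewrite mem_setE in_itv.
have h' x : x \in `[c - b, c]%classic = (c - b <= x <= c).
  by rewrite mem_setE in_itv.
rewrite !h !h'.
have [Is|nIs] := boolP (s \in I); have [Isb|nIsb] := boolP (s + b \in I);
  rewrite /= ?subrr ?subr0 ?sub0r ?normrN ?normr0 ?normr1 ?addr_ge0//.
- suff -> : c - b <= s <= c by rewrite lerDr.
  have /andP[h1 h2] := Iin (set_mem Is); rewrite h2 andbT leNgt; apply/negP => h3.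
  move/negP: nIsb; apply; apply/mem_set/inI; lra.
- suff -> : a - b <= s <= a by rewrite lerDl.
  have /andP[h1 h2] := Iin (set_mem Isb); apply/andP; split; first lra.
  rewrite leNgt; apply/negP => h3.
  move/negP: nIs; apply; apply/mem_set/inI => //; lra.
Qed.

Let jump_ge (s : R) : a <= c - b ->
  ((\1_`](a - b)%R, a[ s)%:E + (\1_`](c - b)%R, c[ s)%:E <= jump I b s)%E.
Proof.
have b0' := b0; move=> ac; rewrite /jump -EFinD lee_fin !indicE.
have h x : x \in `]a - b, a[%classic = (a - b < x < a).
  by rewrite mem_setE in_itv.
have h' x : x \in `]c - b, c[%classic = (c - b < x < c).
  by rewrite mem_setE in_itv.
rewrite !h !h'.
case: (boolP (a - b < s < a)) => [/andP[k1 k2]|k].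
  rewrite (_ : _ && _ = false) ?addr0; last by apply/negP => /andP[]; lra.
  rewrite (mem_set (inI _ _)) ?memNset ?subr0 ?normr1//; [|lra|lra].
  by move=> /Iin; lra.
rewrite add0r; case: (boolP (c - b < s < c)) => [/andP[k1 k2]|k'] /=; last exact: normr_ge0.
rewrite (@memNset _ _ (s + b)) ?(mem_set (inI _ _)) ?sub0r ?normrN ?normr1//; [lra|].
by move=> /Iin; lra.
Qed.

(** A segment differs from its translate by b at most on two segments of length b
near its endpoints a and c. *)
Lemma jump_int_le : (\int[leb]_s jump I b s <= (2 * b)%:E)%E.
Proof.
have b0' := b0; have E x : (\int[leb]_s (\1_`[(x - b)%R, x] s)%:E = b%:E)%E.
  rewrite integral_indic// setIT; apply: etrans (lebesgue_measure_itv _) _.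
  rewrite /= lte_fin gtrBl b0 -EFinB; congr EFin; ring.
apply: (@le_trans _ _ (\int[leb]_s ((\1_`[a - b, a] s)%:E + (\1_`[c - b, c] s)%:E))%E).
  apply: ge0_le_integral.
  - by [].
  - by move=> s _; rewrite /jump lee_fin.
  - exact: mjump.
  - by apply: emeasurable_funD; apply/measurable_EFinP; exact: measurable_indic.
  by move=> s _; exact: jump_le.
rewrite ge0_integralD//.
- by rewrite !E -EFinD; rewrite lee_fin; lra.
- by apply/measurable_EFinP; exact: measurable_indic.
- by apply/measurable_EFinP; exact: measurable_indic.
Qed.

(** When the segment has length at least b, the two segments of length b at its endpoints
are disjoint and the translate does differ there. *)
Lemma jump_int_ge : (exists s, I s /\ I (s + b)) ->
  ((2 * b)%:E <= \int[leb]_s jump I b s)%E.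
Proof.
have b0' := b0; move=> [s0 [/Iin /andP[h1 h2] /Iin/andP[h3 h4]]].
have E x : (\int[leb]_s (\1_`](x - b)%R, x[ s)%:E = b%:E)%E.
  rewrite integral_indic// setIT; apply: etrans (lebesgue_measure_itv _) _.
  rewrite /= lte_fin gtrBl b0 -EFinB; congr EFin; ring.
apply: (@le_trans _ _ (\int[leb]_s ((\1_`]a - b, a[ s)%:E + (\1_`]c - b, c[ s)%:E))%E).
  rewrite ge0_integralD//.
  - by rewrite !E -EFinD; rewrite lee_fin; lra.
  - by apply/measurable_EFinP; exact: measurable_indic.
  - by apply/measurable_EFinP; exact: measurable_indic.
apply: ge0_le_integral.
- by [].
- by move=> s _; rewrite adde_ge0// lee_fin.
- by apply: emeasurable_funD; apply/measurable_EFinP; exact: measurable_indic.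
- exact: mjump.
by move=> s _; apply: jump_ge; lra.
Qed.

End one_dimensional.

Lemma interval_endpoints (R : realType) (I : set R) : is_interval I ->
  has_ubound I -> has_lbound I -> I !=set0 -> exists a c : R,
    (forall x : R, I x -> a <= x <= c) /\ (forall x : R, a < x -> x < c -> I x).
Proof.
move=> itvI ubI lbI I0; exists (inf I), (sup I); split => [x Ix|x].
  by rewrite ge_inf ?ub_le_sup.
move=> /(inf_lt I0)[y Iy yx] /(sup_gt I0)[z Iz xz].
by apply: (itvI _ _ Iy Iz); rewrite (ltW yx) (ltW xz).
Qed.

(** * Continuity, compactness and convexity of sets of row vectors *)

Section topology.
Context (R : realType).

Lemma lipschitz_continuous_fun (V W : normedModType R) (f : V -> W) (C : R) :
  (forall x y, `|f x - f y| <= C * `|x - y|) -> continuous f.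
Proof.
move=> h x; apply/cvgrPdist_le => e e0.
have C0 : 0 < `|C| + 1 by rewrite ltr_pwDr.
near=> y; apply: le_trans (h x y) _.
apply: (@le_trans _ _ ((`|C| + 1) * `|x - y|)).
  by rewrite ler_wpM2r//; have := ler_norm C; lra.
rewrite mulrC -ler_pdivlMr//; near: y.
by apply: cvgr_dist_le; [exact: cvg_id|rewrite divr_gt0].
Unshelve. all: by end_near. Qed.

Lemma mx_norm_le n (x : 'rV[R]_n) (M : R) : 0 <= M ->
  `|x| <= M <-> forall i, `|x ord0 i| <= M.
Proof.
move=> M0; have -> : `|x| = \big[Order.max/0]_ij `|x ij.1 ij.2| by exact: mx_normrE.
split.
  move=> h i; apply: le_trans h.
  by apply/bigmax_geP; right; exists (ord0, i).
by move=> h; apply/bigmax_leP; split => // -[i j] _ /=; rewrite (ord1 i).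
Qed.

Lemma coord_le_norm n (x : 'rV[R]_n) i : `|x ord0 i| <= `|x|.
Proof. exact: (mx_norm_le x (normr_ge0 x)).1 (lexx _) i. Qed.

Lemma norm_dotp_le n (x y : 'rV[R]_n) : `|dotp x y| <= n%:R * `|x| * `|y|.
Proof.
apply: le_trans (ler_norm_sum _ _ _) _.
rewrite -mulrA mulr_natl -[X in _ *+ X](card_ord n) -sumr_const.
by apply: ler_sum => i _; rewrite normrM ler_pM// coord_le_norm.
Qed.

Lemma mulmx_continuous a b (Q : 'M[R]_(a, b)) :
  continuous (fun x : 'rV[R]_a => x *m Q).
Proof.
apply: (@lipschitz_continuous_fun _ _ _ (\sum_i \sum_j `|Q i j|)) => x y.
rewrite -mulmxBl; apply/mx_norm_le.
  by apply: mulr_ge0 => //; apply: sumr_ge0 => i _; exact: sumr_ge0.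
move=> j; rewrite mxE; apply: le_trans (ler_norm_sum _ _ _) _.
rewrite mulr_suml; apply: ler_sum => i _; rewrite normrM mulrC ler_pM//.
  by rewrite (bigD1 j)//= lerDl sumr_ge0.
exact: coord_le_norm.
Qed.

Lemma compact_sub_cube n (K : set 'rV[R]_n) : compact K ->
  exists2 M : R, 0 < M & K `<=` cube M.
Proof.
move=> /compact_bounded/pinfty_ex_gt0[M M0 h]; exists M => // x /h hx.
by apply/mx_norm_le => //; exact: ltW.
Qed.

Lemma compact_measure_lty n (K : set 'rV[R]_n) : compact K -> (lebesgue_rV R n K < +oo)%E.
Proof.
move=> cK; have [M M0 KM] := compact_sub_cube cK.
apply: (@le_lt_trans _ _ (lebesgue_rV R n (cube M))).
  apply: le_measure; rewrite ?inE//; first exact: compact_measurable_rV.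
  exact: measurable_cube.
by rewrite lebesgue_rV_cube ?ltry// ltW.
Qed.

Lemma convex_comb n (K : set 'rV[R]_n) x y t : convex_set K -> K x -> K y ->
  0 <= t -> t <= 1 -> K (t *: x + (1 - t) *: y).
Proof.
move=> cK Kx Ky t0 t1.
by have := cK x y (Itv01 t0 t1) (mem_set Kx) (mem_set Ky) => /set_mem.
Qed.

Lemma convex_set_comb n (K : set 'rV[R]_n) :
  (forall x y t, K x -> K y -> 0 <= t -> t <= 1 -> K (t *: x + (1 - t) *: y)) ->
  convex_set K.
Proof.
move=> h x y t /set_mem Kx /set_mem Ky; apply/mem_set.
by apply: h.
Qed.

End topology.

(** * The shadow of a convex body as a rate of change of translates *)

Section brightness.
Context (R : realType) (m : nat).
Local Notation mu := (lebesgue_rV R).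
Variables (K : set 'rV[R]_m.+1) (u : 'rV[R]_m.+1) (F : 'M[R]_(m, m.+1)).
Hypotheses (cvxK : convex_set K) (cK : compact K).
Hypotheses (u1 : norm2 u = 1) (FF : F *m F^T = 1%:M) (Fu : F *m u^T = 0).

Let P := [set y | exists s, K (s *: u + y *m F)].
Let line y := [set s | K (s *: u + y *m F)].

Lemma shadow_compact : compact P.
Proof.
rewrite /P (proj_image u1 FF Fu); apply: continuous_compact => //.
by apply: continuous_subspaceT; exact: mulmx_continuous.
Qed.

Let mK : measurable K. Proof. exact: compact_measurable_rV. Qed.

Let line_itv y : is_interval (line y).
Proof.
move=> s1 s2 Ks1 Ks2 s /andP[h1 h2]; rewrite /line /=.
have [->//|s12] := eqVneq s s1.
have s21 : 0 < s2 - s1 by move: s12 h1 h2; rewrite neq_lt => /orP[|]; lra.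
pose t := (s2 - s) / (s2 - s1).
have -> : s *: u + y *m F = t *: (s1 *: u + y *m F) + (1 - t) *: (s2 *: u + y *m F).
  rewrite !scalerDr addrACA -scalerDl addrCA subrr addr0 scale1r !scalerA -scalerDl.
  by congr (_ *: _ + _); rewrite /t; field; rewrite gt_eqF.
apply: convex_comb => //; rewrite /t; first by rewrite divr_ge0//; lra.
by rewrite ler_pdivrMr// mul1r; lra.
Qed.

Let line_bounded : exists M : R, forall y s, line y s -> `|s| <= M.
Proof.
have [M M0 KM] := compact_sub_cube cK.
exists (m.+1%:R * M * `|u|) => y s /= Ks.
rewrite -[s in `|s|](dotp_line u1 Fu s y); apply: le_trans (norm_dotp_le _ _) _.
rewrite ler_wpM2r// ler_wpM2l//; apply/mx_norm_le; first exact: ltW.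
exact: KM Ks.
Qed.

Let line_ub y : has_ubound (line y).
Proof. by have [M h] := line_bounded; exists M => s /h; have := ler_norm s; lra. Qed.

Let line_lb y : has_lbound (line y).
Proof.
by have [M h] := line_bounded; exists (- M) => s /h; rewrite ler_norml => /andP[].
Qed.

(** Its integral over x is the volume of the symmetric difference of K and its
translate by - v. *)
Definition jumpK (v x : 'rV[R]_m.+1) : \bar R := `|\1_K (x + v) - \1_K x|%:E.

Lemma jumpK_ge0 v x : (0 <= jumpK v x)%E. Proof. by rewrite lee_fin. Qed.

Lemma measurable_jumpK v : measurable_fun setT (jumpK v).
Proof.
apply/measurable_EFinP; apply: measurableT_comp => //.
apply: measurable_funB; last exact: measurable_indic.
exact: measurableT_comp (measurable_indic mK) (measurable_rV_shift v).
Qed.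

Let jump_line b s y : jumpK (b *: u) (s *: u + y *m F) = jump (line y) b s.
Proof.
rewrite /jumpK /jump !indicE; congr (`|(nat_of_bool _)%:R - _|%:E).
by apply/idP/idP => /set_mem h; apply/mem_set; move: h;
  rewrite /line /= scalerDl addrAC.
Qed.

(** [jump_int_le] on every line that meets K; the other lines contribute 0. *)
Lemma jumpK_int_le b : 0 < b ->
  (\int[mu m.+1]_x jumpK (b *: u) x <= (2 * b)%:E * mu m P)%E.
Proof.
move=> b0.
rewrite (lebesgue_rV_int_lines u1 FF Fu (measurable_jumpK _) (jumpK_ge0 _)).
have mP : measurable P by apply: compact_measurable_rV; exact: shadow_compact.
rewrite -(lebesgue_rV_int_indic mP) -ge0_integralZl//; last 2 first.
- by apply/measurable_EFinP; exact: measurable_indic.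
- by rewrite lee_fin; lra.
apply: ge0_le_integral.
- by [].
- by move=> y _; apply: integral_ge0 => s _; exact: jumpK_ge0.
- exact: measurable_int_lines (measurable_jumpK _) (jumpK_ge0 _).
- apply/measurable_EFinP; apply: measurable_funM => //; exact: measurable_indic.
move=> y _; under eq_integral do rewrite jump_line.
have [Py|nPy] := boolP (y \in P).
  rewrite indicE Py mule1.
  have I0 : line y !=set0 by have [s Ks] := set_mem Py; exists s.
  have [a [c [h1 h2]]] := interval_endpoints (@line_itv y) (line_ub y) (line_lb y) I0.
  exact: (jump_int_le b0 (@line_itv y) h1 h2).
rewrite indicE (negbTE nPy) mule0.
have -> : line y = set0.
  by rewrite -subset0 => s Ks; move/negP: nPy; apply; apply/mem_set; exists s.
by rewrite integral0_eq// => s _; exact: jump0.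
Qed.

(** [jump_int_ge] needs lines that meet K in a segment of length at least b.  Contract
K by the factor 1 - d towards an interior point c: through each point of the
contracted body passes a segment in K, in direction u, of half-length close to d r.
So all lines over the contracted shadow, whose volume is (1 - d)^m times that of
the shadow, have this property. *)
Lemma jumpK_int_ge (c : 'rV[R]_m.+1) (r d b : R) :
  0 < r -> ball c r `<=` K -> 0 < d -> d < 1 -> 0 < b -> b <= d * r / 2 ->
  ((2 * b * (1 - d) ^+ m)%:E * mu m P <= \int[mu m.+1]_x jumpK (b *: u) x)%E.
Proof.
move=> r0 hr d0 d1 b0 br.
have Kc (x : 'rV[R]_m.+1) : (forall i, `|x ord0 i - c ord0 i| < r) -> K x.
  by move=> h; apply: hr; apply/mx_ballE => // i; rewrite distrC.
have mP : measurable P by apply: compact_measurable_rV; exact: shadow_compact.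
pose w : 'rV[R]_m := - (d *: (c *m F^T)).
pose P' := (fun y => y + w) @^-1` ((fun y => (1 - d)^-1 *: y) @^-1` P).
have d1' : 0 < 1 - d by lra.
have mscale : measurable ((fun y : 'rV[R]_m => (1 - d)^-1 *: y) @^-1` P).
  exact: measurable_preimage (measurable_rV_scale _) mP.
have mP' : measurable P' by exact: measurable_preimage (measurable_rV_shift w) mscale.
have -> : ((2 * b * (1 - d) ^+ m)%:E * mu m P = (2 * b)%:E * mu m P')%E.
  rewrite /P' lebesgue_rV_translate// lebesgue_rV_scale ?invr_gt0// invrK.
  by rewrite muleA -EFinM.
rewrite (lebesgue_rV_int_lines u1 FF Fu (measurable_jumpK _) (jumpK_ge0 _)).
rewrite -(lebesgue_rV_int_indic mP') -ge0_integralZl//; last 2 first.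
- by apply/measurable_EFinP; exact: measurable_indic.
- by rewrite lee_fin; lra.
apply: ge0_le_integral.
- by [].
- by move=> y _; rewrite mule_ge0// lee_fin; lra.
- apply/measurable_EFinP; apply: measurable_funM => //; exact: measurable_indic.
- exact: measurable_int_lines (measurable_jumpK _) (jumpK_ge0 _).
move=> y _; under eq_integral do rewrite jump_line.
rewrite indicE; have [/set_mem Py|nPy] := boolP (y \in P'); last first.
  by rewrite mule0; apply: integral_ge0 => s _; rewrite lee_fin.
rewrite mule1.
have [s Ks] := Py.
set x := _ + _ in Ks.
have yE : y *m F = (1 - d) *: (((1 - d)^-1 *: (y + w)) *m F) + d *: (c *m F^T *m F).
  rewrite -scalemxAl scalerA mulfV ?gt_eqF// scale1r mulmxDl /w mulNmx -scalemxAl.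
  by rewrite subrK.
pose s0 := (1 - d) * s + d * dotp c u.
have line_tau (tau : R) : `|tau| <= b -> line y (s0 + tau).
  move=> htau; rewrite /line /=.
  have -> : (s0 + tau) *: u + y *m F = (1 - d) *: x + (1 - (1 - d)) *: (c + (tau / d) *: u).
    rewrite yE /x {2}(frame_decomp u1 FF Fu c) /s0.
    move: (_ *m F) (_ *m F) (dotp c u) => z e k.
    by apply/rowP => i; rewrite !mxE; field; rewrite gt_eqF.
  apply: convex_comb => //; try lra.
  apply: Kc => i; rewrite !mxE addrAC subrr add0r normrM.
  have ui : `|u ord0 i| <= 1 by rewrite -u1 coord_le_norm2.
  have : `|tau / d| * `|u ord0 i| <= `|tau / d| by rewrite ler_piMr.
  move=> h; apply: le_lt_trans h _.
  rewrite normrM (gtr0_norm (x := d^-1)) ?invr_gt0// ltr_pdivrMr//.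
  by move: br; rewrite ler_pdivlMr//; lra.
have [a [e [h1 h2]]] : exists a c : R, (forall x : R, line y x -> a <= x <= c) /\
    (forall x : R, a < x -> x < c -> line y x).
  apply: interval_endpoints => //.
  by exists (s0 + 0); apply: line_tau; rewrite normr0 ltW.
apply: (jump_int_ge b0 (@line_itv y) h1 h2).
exists s0; split; last by apply: line_tau; rewrite gtr0_norm.
by rewrite -[s0]addr0; apply: line_tau; rewrite normr0 ltW.
Qed.

End brightness.

(** * Orthonormal bases of hyperplanes *)

Section hyperplane_basis.
Context (R : realType) (m : nat).

(** The Householder reflection that exchanges u and the first basis vector e. *)
Lemma orthogonal_first_row (u : 'rV[R]_m.+1) : norm2 u = 1 ->
  exists H : 'M[R]_m.+1, H *m H^T = 1%:M /\ row ord0 H = u.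
Proof.
move=> /norm2_eq1 u1; pose e : 'rV[R]_m.+1 := delta_mx ord0 ord0.
have ee : dotp e e = 1 by rewrite dotp_delta mxE !eqxx.
have eu : dotp e u = u ord0 ord0 by rewrite dotpC dotp_delta.
have e1 : row ord0 1%:M = e by rewrite row1.
have [->|ue] := eqVneq u e; first by exists 1%:M; rewrite trmx1 mulmx1.
pose v := u - e; pose k := dotp v v.
have kE : k = 2 - 2 * u ord0 ord0.
  rewrite /k /v dotpDl !dotpDr -scaleN1r !dotpZl !dotpZr (dotpC u) u1 ee eu; ring.
have k0 : k != 0.
  rewrite /k -norm2_sqr sqrf_eq0; apply: contra ue => /eqP/norm2_eq0.
  by move=> /eqP; rewrite subr_eq0.
pose H : 'M[R]_m.+1 := 1%:M - (2 / k) *: (v^T *m v).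
have HT : H^T = H.
  by rewrite /H linearB /= linearZ /= trmx_mul trmxK trmx1.
exists H; split.
  have vv : v *m v^T = k%:M.
    by apply/rowP => i; rewrite !ord1 -dotpE mxE eqxx mulr1n.
  have AA : v^T *m v *m (v^T *m v) = k *: (v^T *m v).
    by rewrite mulmxA -(mulmxA _ v) vv mul_mx_scalar -scalemxAl.
  rewrite HT /H; move: (v^T *m v) AA => A AA.
  rewrite mulmxBl mul1mx mulmxBr mulmx1 -scalemxAl -scalemxAr AA.
  by apply/matrixP => i j; rewrite !mxE; field.
rewrite /H linearB /= e1 linearZ /= row_mul.
have -> : row ord0 v^T = (u ord0 ord0 - 1)%:M.
  by apply/rowP => i; rewrite !ord1 !mxE eqxx mulr1n.
rewrite mul_scalar_mx scalerA.
have -> : 2 / k * (u ord0 ord0 - 1) = -1.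
  have -> : u ord0 ord0 - 1 = - k / 2 by rewrite kE; field.
  by field.
by rewrite scaleN1r opprK /v addrC subrK.
Qed.

Lemma hyperplane_basisP (u : 'rV[R]_m.+1) : norm2 u = 1 ->
  hyperplane_basis u *m (hyperplane_basis u)^T = 1%:M /\
  hyperplane_basis u *m u^T = 0.
Proof.
move=> /orthogonal_first_row[H [HH Hu]].
have := @xgetPex _ 0 [set F : 'M[R]_(m.+1.-1, m.+1) | F *m F^T = 1%:M /\ F *m u^T = 0].
apply; exists (row' ord0 H) => /=; split.
  apply/matrixP => i j; have := congr1 (fun A : 'M[R]_m.+1 => A (lift ord0 i) (lift ord0 j)) HH.
  rewrite !mxE (inj_eq (@lift_inj _ _)) => <-.
  by apply: eq_bigr => k _; rewrite !mxE.
apply/matrixP => i j.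
have e : (H *m H^T) (lift ord0 i) ord0 = 0 by rewrite HH mxE.
rewrite mxE in e; rewrite !mxE -[RHS]e.
by apply: eq_bigr => k _; rewrite -Hu !mxE.
Qed.

End hyperplane_basis.

(** * Support functions *)

Section support.
Context (R : realType) (n : nat).
Implicit Types (K D : set 'rV[R]_n) (x y : 'rV[R]_n).

Lemma support_ub K x y : compact K -> K y -> dotp x y <= support_fun K x.
Proof.
move=> cK Ky; apply: ub_le_sup; last by exists y.
have [M M0 KM] := compact_sub_cube cK.
exists (n%:R * `|x| * M) => _ [z Kz <-]; apply: le_trans (ler_norm _) _.
apply: le_trans (norm_dotp_le _ _) _; rewrite ler_wpM2l ?mulr_ge0//.
by apply/mx_norm_le; [exact: ltW|exact: KM].
Qed.

Lemma support_ge0 K x : compact K -> K 0 -> 0 <= support_fun K x.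
Proof.
move=> cK K0; apply: le_trans (support_ub x cK K0).
by rewrite -(scale0r (0 : 'rV[R]_n)) dotpZr mul0r.
Qed.

Lemma support_le K x (M : R) : K !=set0 -> (forall y, K y -> dotp x y <= M) ->
  support_fun K x <= M.
Proof.
move=> [y Ky] h; apply: ge_sup; first by exists (dotp x y), y.
by move=> _ [z Kz <-]; exact: h.
Qed.

Lemma support_scale K x (t : R) : compact K -> K !=set0 -> 0 <= t ->
  support_fun K (t *: x) = t * support_fun K x.
Proof.
move=> cK K0 t0; have [->|tn0] := eqVneq t 0.
  rewrite scale0r mul0r; apply/eqP; rewrite eq_le; apply/andP; split.
    by apply: support_le => // y _; rewrite -(scale0r 0) dotpZl mul0r.
  have [y Ky] := K0; have := support_ub 0 cK Ky.
  by rewrite -{1}(scale0r 0) dotpZl mul0r.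
have {}t0 : 0 < t by rewrite lt_def tn0.
apply/eqP; rewrite eq_le; apply/andP; split.
  by apply: support_le => // y Ky; rewrite dotpZl ler_pM2l//; exact: support_ub.
rewrite mulrC -ler_pdivlMr//; apply: support_le => // y Ky.
by rewrite ler_pdivlMr// mulrC -dotpZl; exact: support_ub.
Qed.

Lemma support_continuous K : compact K -> K !=set0 -> continuous (support_fun K).
Proof.
move=> cK K0; have [M M0 KM] := compact_sub_cube cK.
have h x y : support_fun K x <= support_fun K y + n%:R * M * `|x - y|.
  apply: support_le => // z Kz.
  rewrite -[x in dotp x](subrK y) dotpDl addrC lerD//; first exact: support_ub.
  apply: le_trans (ler_norm _) _; apply: le_trans (norm_dotp_le _ _) _.
  rewrite mulrAC ler_wpM2r// ler_wpM2l//.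
  by apply/mx_norm_le; [exact: ltW|exact: KM].
apply: (@lipschitz_continuous_fun _ _ _ _ (n%:R * M)) => x y.
rewrite ler_norml; apply/andP; split.
  by have := h y x; rewrite distrC; lra.
by have := h x y; lra.
Qed.

End support.

(** * Khintchine's inequality for support functions of projection bodies *)

Section projection_average.
Context (R : realType) (m : nat).
Local Notation n := m.+1.
Local Notation mu := (lebesgue_rV R).
Variables (K D : set 'rV[R]_n).
Hypotheses (bK : convex_body K) (pD : projection_body_of K D).

Let cvxK : convex_set K. Proof. by case: bK. Qed.
Let cK : compact K. Proof. by case: bK. Qed.
Let cD : compact D. Proof. by case: pD => -[]. Qed.
Let D0 : D !=set0.
Proof. by case: pD => -[_ _ [x /nbhs_singleton Dx]]; exists x. Qed.
Let f : 'rV[R]_n -> R := \1_K.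

Let L1f : L1 f.
Proof.
have mK : measurable K by exact: compact_measurable_rV.
apply/integrableP; split; first by apply/measurable_EFinP; exact: measurable_indic.
rewrite (eq_integral (fun x => (\1_K x)%:E)); last first.
  by move=> x _; rewrite gee0_abs// lee_fin.
by rewrite lebesgue_rV_int_indic//; exact: compact_measure_lty.
Qed.

Let h := support_fun D.

Let shift_modulusE v : (shift_modulus f v)%:E = (\int[mu n]_x jumpK K v x)%E.
Proof.
rewrite /shift_modulus /norm1 /Rintegral fineK//.
have : L1 (fun x => `|f (x + v) - f x|).
  apply: L1_norm; have := L1D (L1_shift v L1f) (L1Z (-1) L1f).
  by rewrite (_ : _ + _ = (fun x => f (x + v) - f x))// scaleN1r.
by move/integrable_fin_num => -> //.
Qed.

Lemma shift_modulus_le_support v : shift_modulus f v <= 2 * h v.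
Proof.
have [->|v0] := eqVneq v 0.
  rewrite -(scale0r (0 : 'rV[R]_n)) /h support_scale// mul0r mulr0.
  rewrite le_eqVlt; apply/orP; left; apply/eqP.
  rewrite /shift_modulus /norm1 /Rintegral.
  under eq_integral do rewrite scale0r addr0 subrr normr0.
  by rewrite integral0.
have t0 : 0 < norm2 v.
  by rewrite lt_def norm2_ge0 andbT; apply: contra v0 => /eqP/norm2_eq0 ->.
set t := norm2 v in t0; pose u := t^-1 *: v.
have u1 : norm2 u = 1 by rewrite norm2Z gtr0_norm ?invr_gt0// mulVf// gt_eqF.
have vE : v = t *: u by rewrite /u scalerA mulfV ?scale1r// gt_eqF.
have [FF Fu] := hyperplane_basisP u1.
have := jumpK_int_le cvxK cK u1 FF Fu t0.
rewrite -(proj_lines u1 Fu) -vE -shift_modulusE.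
have [_ _ /(_ u u1)] := pD; rewrite /hyperplane_volume /= => <-.
rewrite -EFinM lee_fin => hq; apply: le_trans hq _.
have -> : h v = t * h u.
  by rewrite [in LHS]vE; apply: support_scale => //; exact: ltW.
by rewrite mulrA.
Qed.

(** The loss in [jumpK_int_ge] stays bounded when d is of order 1 / n. *)
Lemma bernoulli_half : 1 / 2 <= (1 - (2 * n%:R)^-1) ^+ m :> R.
Proof.
apply: le_trans (bernoulli_ineq m (d := (2 * n%:R)^-1) _ _).
- rewrite -[n%:R]natr1; have m0 : 0 <= m%:R :> R by [].
  have -> : 1 - m%:R * (2 * (m%:R + 1))^-1 = 1 / 2 + (2 * (m%:R + 1))^-1 :> R.
    by field; lra.
  by rewrite lerDl invr_ge0; lra.
- by rewrite invr_ge0.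
- rewrite invf_le1 ?mulr_gt0// -natrM ler1n//.
Qed.

Hypothesis BD : cross_polytope R n `<=` D.

(** [shift_modulus_transfer] for the indicator function of K and the majorant 2 h.
On the left, for b small, [jumpK_int_ge] bounds the modulus below by b |xi_j| times
h in the direction of plus or minus e_j, and there h is at least 1 because D contains
the cross-polytope. *)
Lemma projection_average (xi : 'rV[R]_n) : norm2 xi <= 1 ->
  \sum_j `|xi ord0 j| <=
  4 * Num.sqrt n%:R * sign_avg h [seq xi ord0 j *: delta_mx ord0 j | j <- enum 'I_n] 0.
Proof.
move=> xi1; set ws := [seq _ | _ <- _].
have sws : size ws = n by rewrite size_map size_enum_ord.
have [_ _ [c Kc]] := bK.
have /nbhs_ballP[r /= r0 hr] : nbhs (c : 'rV[R]_n) K := Kc.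
pose d : R := (2 * n%:R)^-1.
have d0 : 0 < d by rewrite /d invr_gt0 -natrM ltr0n.
have d1 : d < 1 by rewrite /d invf_lt1 -natrM ?ltr0n// ltr1n mulnS.
pose b := d * r / 2; have b0 : 0 < b by rewrite /b divr_gt0// mulr_gt0.
have hZ (t : R) v : 0 < t -> 2 * h (t *: v) = t * (2 * h v).
  by move=> t0; rewrite /h support_scale ?(ltW t0)// mulrCA.
have := @shift_modulus_transfer R n f (fun v => 2 * h v) ws b L1f
  shift_modulus_le_support hZ b0.
rewrite sws => tr.
have low j : b * `|xi ord0 j| <= shift_modulus f (b *: (xi ord0 j *: delta_mx ord0 j)).
  set t := `|xi ord0 j|.
  have t1 : t <= 1 by apply: le_trans (coord_le_norm2 _ _) xi1.
  have := normr_ge0 (xi ord0 j); rewrite -/t le_eqVlt => /orP[/eqP t00|t0].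
    rewrite -t00 mulr0; apply: Rintegral_ge0 => //.
  pose u : 'rV[R]_n := Num.sg (xi ord0 j) *: delta_mx ord0 j.
  have uE : b *: (xi ord0 j *: delta_mx ord0 j) = (b * t) *: u.
    by rewrite /u !scalerA -mulrA [t * _]mulrC /t -numEsg.
  have sg1 : `|Num.sg (xi ord0 j)| = 1.
    by rewrite normr_sg -normr_gt0 -/t t0.
  have u1 : norm2 u = 1 by rewrite norm2_axis.
  have uu : dotp u u = 1 by apply/norm2_eq1.
  have Du : D u by apply: BD; apply: cross_polytope_axis; rewrite sg1.
  have hu : 1 <= h u by rewrite -uu; exact: support_ub.
  have [FF Fu] := hyperplane_basisP u1.
  have bt0 : 0 < b * t by rewrite mulr_gt0.
  have btle : b * t <= d * r / 2 by rewrite -[leRHS]mulr1 ler_wpM2l// ltW.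
  have := jumpK_int_ge cvxK cK u1 FF Fu r0 hr d0 d1 bt0 btle.
  rewrite -(proj_lines u1 Fu) -uE -shift_modulusE.
  have [_ _ /(_ u u1)] := pD; rewrite /hyperplane_volume /= => <-.
  rewrite -EFinM lee_fin; apply: le_trans.
  have := bernoulli_half; rewrite -/d; move: (_ ^+ m) => B B2.
  have B0 : 0 <= B by lra.
  apply: (@le_trans _ _ (2 * (b * t) * B)).
    have : b * t * 1 <= b * t * (2 * B) by rewrite ler_pM2l//; lra.
    lra.
  by rewrite -[leLHS]mulr1 ler_wpM2l// !mulr_ge0// ltW.
have S : b * \sum_j `|xi ord0 j| <= \sum_(w <- ws) shift_modulus f (b *: w).
  rewrite /ws big_map big_enum mulr_sumr; apply: ler_sum => j _; exact: low.
have k0 : 0 < 2 * Num.sqrt n%:R :> R by rewrite mulr_gt0// sqrtr_gt0.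
move: tr; rewrite mulrC ler_pdivrMr// => tr.
have := le_trans S tr; rewrite -(mulrA b) (ler_pM2l b0).
have -> : sign_avg (fun v => 2 * h v) ws 0 = 2 * sign_avg h ws 0.
  have := sign_avg_lin h h 2 0 ws 0; rewrite mul0r addr0 => <-.
  by congr (sign_avg _ _ _); apply/funext => y; rewrite mul0r addr0.
by move=> le; apply: le_trans le _; rewrite le_eqVlt; apply/orP; left; apply/eqP; ring.
Qed.

End projection_average.

(** * The measure on the sphere *)

Section sphere_measure_theory.
Context (R : realType) (m : nat).
Local Notation n := m.+1.
Local Notation mu := (lebesgue_rV R n).
Local Notation sigma := (@sphere_measure R n).
Local Notation B := (@ball2 R n).
Local Notation S := (@sphere R n).

Lemma measurable_sphere : measurable S.
Proof.
have -> : S = (@norm2 R n) @^-1` [set 1].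
  by apply/seteqP; split.
exact: measurable_preimage (@measurable_norm2 R n) _.
Qed.

Let vol := fine (mu B).

Let volE : mu B = vol%:E.
Proof. by rewrite /vol fineK// ge0_fin_numE// ball2_lty. Qed.

Let vol_gt0 : 0 < vol.
Proof. by have := ball2_gt0 R n; rewrite volE lte_fin. Qed.

Lemma sphere_measureE (A : set 'rV[R]_n) :
  sigma A = (vol^-1%:E * mu (@direction R n @^-1` A `&` B))%E.
Proof. by []. Qed.

Lemma measurable_direction_preimage (A : set 'rV[R]_n) :
  measurable A -> measurable (@direction R n @^-1` A `&` B).
Proof.
move=> mA; apply: measurableI; last exact: measurable_ball2.
exact: measurable_preimage (@measurable_direction R n) mA.
Qed.

(** All upper bounds on the measure of a part A of the sphere come from a set that
contains the cone over A in the unit ball. *)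
Lemma sphere_measure_le (A C : set 'rV[R]_n) (k : R) : measurable A -> measurable C ->
  (forall x, B x -> A (direction x) -> C x) -> (mu C <= k%:E * mu B)%E ->
  (sigma A <= k%:E)%E.
Proof.
move=> mA mC AC Ck; rewrite sphere_measureE.
have : (mu (@direction R n @^-1` A `&` B) <= k%:E * mu B)%E.
  apply: le_trans Ck; apply: le_measure; rewrite ?inE//.
    exact: measurable_direction_preimage.
  by move=> x [Ax Bx]; exact: AC.
rewrite volE => h.
apply: (@le_trans _ _ (vol^-1%:E * (k%:E * vol%:E))%E).
  by apply: lee_wpmul2l => //; rewrite lee_fin invr_ge0 ltW.
by rewrite -!EFinM mulrCA mulVf ?mulr1// gt_eqF.
Qed.

Lemma norm2_direction (x : 'rV[R]_n) : x != 0 -> norm2 (direction x) = 1.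
Proof.
move=> x0; rewrite /direction norm2Z ger0_norm ?invr_ge0 ?norm2_ge0//.
rewrite mulVf//; apply: contra x0 => /eqP/norm2_eq0 ->; exact: eqxx.
Qed.

Lemma directionE (x : 'rV[R]_n) : x = norm2 x *: direction x.
Proof.
have [->|x0] := eqVneq x 0; first by rewrite /direction !scaler0.
rewrite /direction scalerA mulfV ?scale1r//.
by apply: contra x0 => /eqP/norm2_eq0 ->.
Qed.

(** Dilation by 2 multiplies the volume of the origin by a constant other than 1 and
leaves the origin unchanged. *)
Lemma lebesgue_rV_set0 : mu [set 0] = 0%E.
Proof.
have m0 : measurable [set (0 : 'rV[R]_n)].
  by apply: compact_measurable_rV; exact: compact_set1.
have : (mu [set (0%R : 'rV[R]_n)] <= mu B)%E.
  apply: le_measure; rewrite ?inE//; first exact: measurable_ball2.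
  by move=> _ ->; rewrite /ball2 /= norm2_le1 -(scale0r (0 : 'rV[R]_n)) dotpZl mul0r.
have := @lebesgue_rV_scale R n 2 _ (ltr0Sn _ _) m0.
rewrite (_ : _ @^-1` _ = [set 0]); last first.
  apply/seteqP; split => x /=; last by move=> ->; rewrite scaler0.
  by move/eqP; rewrite scaler_eq0 pnatr_eq0 /= => /eqP.
have : (0 <= mu [set (0%R : 'rV[R]_n)])%E by [].
case: (mu _) => [r| |] //; last by rewrite volE.
rewrite !lee_fin -EFinM => r0 [] e _; congr EFin.
have : (2^-1 : R) ^+ n < 1.
  by rewrite exprn_ilt1// invf_lt1// ltr1n.
move: e; move: (_ ^+ n) => k e k1.
have : r * (1 - k) == 0 by rewrite mulrBr mulr1 [r * k]mulrC -e subrr.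
rewrite mulf_eq0 => /orP[/eqP //|]; rewrite subr_eq0 => /eqP k1'.
by move: k1; rewrite -k1' ltxx.
Qed.

Lemma sphere_measureC : sigma (~` S) = 0%E.
Proof.
apply/eqP; rewrite eq_le measure_ge0 andbT.
apply: (@sphere_measure_le _ [set 0] 0).
- by apply: measurableC; exact: measurable_sphere.
- by apply: compact_measurable_rV; exact: compact_set1.
- move=> x _ nSx /=; apply/eqP; apply: contra_notT nSx => x0; exact: norm2_direction.
- by rewrite lebesgue_rV_set0 mul0e.
Qed.

Lemma sphere_measureT : sigma setT = 1%E.
Proof.
by rewrite sphere_measureE preimage_setT setTI volE -EFinM mulVf// gt_eqF.
Qed.

Lemma sphere_measure_sphere : sigma S = 1%E.
Proof.
have : sigma (S `|` ~` S) = (sigma S + sigma (~` S))%E.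
  apply: measureU; [exact: measurable_sphere|exact: measurableC measurable_sphere|].
  exact: setICr.
by rewrite setUv sphere_measureT sphere_measureC adde0.
Qed.

Lemma direction_mul (Q : 'M[R]_n) x : Q *m Q^T = 1%:M ->
  direction (x *m Q) = direction x *m Q.
Proof. by move=> hQ; rewrite /direction norm2_mul// scalemxAl. Qed.

Lemma sphere_measure_orthogonal (Q : 'M[R]_n) (A : set 'rV[R]_n) :
  Q *m Q^T = 1%:M -> measurable A -> sigma ((fun x => x *m Q) @^-1` A) = sigma A.
Proof.
move=> hQ mA; rewrite !sphere_measureE; congr (_ * _)%E.
rewrite -[RHS](lebesgue_rV_orthogonal hQ); last exact: measurable_direction_preimage.
congr (mu _); apply/seteqP; split => x /=.
  by move=> [h1 h2]; rewrite direction_mul// /ball2 /= norm2_mul.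
by rewrite direction_mul// /ball2 /= norm2_mul.
Qed.

Lemma sphere_int_orthogonal (Q : 'M[R]_n) (f : 'rV[R]_n -> \bar R) :
  Q *m Q^T = 1%:M -> measurable_fun setT f -> (forall x, 0 <= f x)%E ->
  (\int[sigma]_(x in S) f (x *m Q) = \int[sigma]_(x in S) f x)%E.
Proof.
move=> hQ mf f0.
rewrite [RHS](@eq_measure_integral _ _ _ S
  (image_measure (measurable_rV_mul Q) sigma)); last first.
  by move=> A mA _; exact: esym (sphere_measure_orthogonal hQ mA).
rewrite (ge0_integral_pushforward (measurable_rV_mul Q)) //.
- have -> // : (fun x => x *m Q) @^-1` S = S.
  by apply/funext => x; rewrite /sphere /= norm2_mul.
- exact: measurable_sphere.
- exact: measurable_funTS.
Qed.

(** Small ball estimate for a coordinate.  The cone over the slab lies in the slab Sl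
of the ball.  Contracted by theta = 1 - 1 / (4 n), Sl has two disjoint copies
in the ball, itself and its translate by 2 a e_j; each has at least 3/4 of the
volume of Sl. *)
Lemma sphere_slab_le (j : 'I_n) (a : R) : 0 < a -> 32 * n%:R * a ^+ 2 <= 1 ->
  (sigma [set x : 'rV[R]_n | (`|x ord0 j| < a)%R] <= (2 / 3)%:E)%E.
Proof.
move=> a0 an.
have mslab := @measurable_slab R n j a.
pose Sl := B `&` [set x : 'rV[R]_n | `|x ord0 j| < a].
have mSl : measurable Sl by apply: measurableI => //; exact: measurable_ball2.
apply: (@sphere_measure_le _ Sl) => //.
  move=> x Bx hx; split => //=; apply: le_lt_trans hx.
  rewrite {1}(directionE x) mxE normrM ger0_norm ?norm2_ge0//.
  by rewrite ler_piMl.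
have n0 : 0 < n%:R :> R by rewrite ltr0n.
have [q [qE q0 q_le]] : exists q : R, [/\ q = (4 * n%:R)^-1, 0 < q & q <= 1 / 4].
  exists (4 * n%:R)^-1; split => //.
  by rewrite div1r lef_pV2 ?posrE ?mulr_gt0// ler_peMr// ler1n.
pose theta : R := 1 - q.
have th0 : 0 < theta by rewrite /theta; lra.
have th1 : theta <= 1 by rewrite /theta; lra.
have thn : 3 / 4 <= theta ^+ n.
  apply: le_trans (bernoulli_ineq n (d := q) _ _); [|exact: ltW|lra].
  by rewrite qE le_eqVlt; apply/orP; left; apply/eqP; field; rewrite gt_eqF.
pose e : 'rV[R]_n := delta_mx ord0 j.
pose A1 := (fun x : 'rV[R]_n => theta^-1 *: x) @^-1` Sl.
pose A2 := (fun x : 'rV[R]_n => x - (2 * a) *: e) @^-1` A1.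
have mA1 : measurable A1.
  exact: measurable_preimage (measurable_rV_scale _) mSl.
have mA2 : measurable A2 by exact: measurable_preimage (measurable_rV_shift _) mA1.
have muA1 : mu A1 = ((theta ^+ n)%:E * mu Sl)%E.
  by rewrite /A1 lebesgue_rV_scale ?invr_gt0// invrK.
have muA2 : mu A2 = ((theta ^+ n)%:E * mu Sl)%E.
  by rewrite /A2 lebesgue_rV_translate.
have A1E x : A1 x -> dotp x x <= theta ^+ 2 /\ `|x ord0 j| < a.
  move=> [/=]; rewrite /ball2 /= norm2_le1 dotpZl dotpZr mulrA -expr2 exprVn.
  rewrite mulrC ler_pdivrMr ?exprn_gt0// mul1r => h1.
  rewrite mxE normrM (gtr0_norm (x := theta^-1)) ?invr_gt0// mulrC ltr_pdivrMr// => h2.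
  split => //; apply: lt_le_trans h2 _; by rewrite ler_piMr// ltW.
have dE x : dotp (x + (2 * a) *: e) (x + (2 * a) *: e) =
    dotp x x + 4 * a * x ord0 j + 4 * a ^+ 2.
  have xe : dotp x e = x ord0 j by exact: dotp_delta.
  have ee : dotp e e = 1 by rewrite dotp_delta mxE !eqxx.
  by rewrite dotpDl !dotpDr !dotpZl !dotpZr (dotpC e) xe ee; ring.
have dis : A1 `&` A2 = set0.
  rewrite -subset0 => x [/A1E[_ h1] /A1E[_ h2]]; move: h1 h2.
  by rewrite !mxE !eqxx mulr1 !ltr_norml => /andP[? ?] /andP[? ?]; lra.
have sub : A1 `|` A2 `<=` B.
  move=> x [/A1E[h _]|/A1E[h1 h2]]; rewrite /ball2 /= norm2_le1.
    by apply: le_trans h _; rewrite expr_le1// ltW.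
  rewrite -(subrK ((2 * a) *: e) x) dE; move: h1 h2.
  set y := x - _ => h1; rewrite ltr_norml => /andP[_ h2].
  have t2 : theta ^+ 2 <= theta by rewrite expr2 ler_piMr// ltW.
  have : 4 * a * y ord0 j <= 4 * a * a by rewrite ler_wpM2l ?mulr_ge0// ltW.
  have a8 : 8 * a ^+ 2 <= q.
    rewrite qE -[leRHS]mul1r ler_pdivlMr ?mulr_gt0//.
    by move: an; lra.
  rewrite /theta in t2 h1 *; lra.
have : (mu (A1 `|` A2) <= mu B)%E.
  by apply: le_measure; rewrite ?inE//; [exact: measurableU|exact: measurable_ball2].
have U : mu (A1 `|` A2) = (mu A1 + mu A2)%E by exact: measureU.
rewrite U muA1 muA2 volE.
have SlB : (mu Sl <= mu B)%E.
  by apply: le_measure; rewrite ?inE//; [exact: measurable_ball2|move=> x []].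
have : (0 <= mu Sl)%E by [].
move: SlB; rewrite volE; case: (mu Sl) => [x| |]//; rewrite -?EFinM -?EFinD !lee_fin => h1 h2 h3.
by have : 3 / 4 * x <= theta ^+ n * x; [rewrite ler_wpM2r|lra].
Qed.

(** The cone over a cap of height s lies in the ball of radius sqrt (1 - s^2)
about s e.  The hypothesis on s is what makes the apex of the cone lie in that
ball. *)
Lemma sphere_cap_le (e : 'rV[R]_n) (s : R) : norm2 e = 1 -> 0 <= s -> 2 * s ^+ 2 <= 1 ->
  (sigma (S `&` [set x : 'rV[R]_n | (s <= dotp x e)%R]) <= (Num.sqrt (1 - s ^+ 2) ^+ n)%:E)%E.
Proof.
move=> e1 s0 s1; set rho := Num.sqrt _.
have r2 : 0 < 1 - s ^+ 2 by lra.
have rho0 : 0 < rho by rewrite sqrtr_gt0.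
have rho2 : rho ^+ 2 = 1 - s ^+ 2 by rewrite sqr_sqrtr// ltW.
pose C0 := (fun x : 'rV[R]_n => rho^-1 *: x) @^-1` B.
have mC0 : measurable C0.
  exact: measurable_preimage (measurable_rV_scale _) (@measurable_ball2 R n).
pose C := (fun x : 'rV[R]_n => x - s *: e) @^-1` C0.
have mC : measurable C by exact: measurable_preimage (measurable_rV_shift _) mC0.
apply: (@sphere_measure_le _ C) => //.
- by apply: measurableI; [exact: measurable_sphere|exact: measurable_halfspace].
- move=> x; rewrite /ball2 /= => Bx [_ /= hs].
  rewrite /C /C0 /= /ball2 /= norm2_le1 dotpZl dotpZr mulrA -expr2 exprVn.
  rewrite mulrC ler_pdivrMr ?exprn_gt0// mul1r rho2.
  rewrite -[- (s *: e)]scaleNr dotpDl !dotpDr !dotpZl !dotpZr (dotpC e) ((norm2_eq1 e).1 e1).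
  rewrite -norm2_sqr.
  have : norm2 x * s <= dotp x e.
    by rewrite [in leRHS](directionE x) dotpZl ler_wpM2l ?norm2_ge0.
  have := norm2_ge0 x; move: (norm2 x) (dotp x e) Bx => t k t1 t0 h.
  have : s * (t * s) <= s * k by rewrite ler_wpM2l.
  have : 0 <= t * (1 - t) by rewrite mulr_ge0//; lra.
  have : 0 <= (1 - t) * (1 - 2 * s ^+ 2) by rewrite mulr_ge0//; lra.
  lra.
- rewrite /C lebesgue_rV_translate// /C0 lebesgue_rV_scale ?invr_gt0// ?invrK//.
  exact: measurable_ball2.
Qed.

End sphere_measure_theory.

(** * Balls are projection bodies *)

Section euclidean_balls.
Context (R : realType).

Lemma norm2D n (x y : 'rV[R]_n) : norm2 (x + y) <= norm2 x + norm2 y.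
Proof.
rewrite -(@ler_pXn2r _ 2)// ?nnegrE ?addr_ge0 ?norm2_ge0//.
rewrite norm2_sqr dotpDl !dotpDr (dotpC y) sqrrD -!norm2_sqr.
by have := cauchy_schwarz x y; lra.
Qed.

Lemma norm2_le_norm n (x : 'rV[R]_n) : norm2 x <= n%:R * `|x|.
Proof.
rewrite -(@ler_pXn2r _ 2)// ?nnegrE ?mulr_ge0 ?norm2_ge0// norm2_sqr.
apply: le_trans (ler_norm _) _; apply: le_trans (norm_dotp_le _ _) _.
rewrite exprMn -mulrA -expr2 ler_wpM2r ?sqr_ge0// -natrX ler_nat.
by case: (n) => // k; rewrite leq_pmulr.
Qed.

Lemma norm2_continuous n : continuous (@norm2 R n).
Proof.
apply: (@lipschitz_continuous_fun _ _ _ _ n%:R) => x y.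
apply: le_trans (norm2_le_norm (x - y)).
have h (z w : 'rV[R]_n) : norm2 z <= norm2 w + norm2 (z - w).
  by rewrite -{1}(subrK w z) addrC; exact: norm2D.
rewrite ler_norml; apply/andP; split; last by have := h x y; lra.
have := h y x; rewrite -opprB -scaleN1r norm2Z normrN1 mul1r; lra.
Qed.

Definition centered_ball n (r : R) : set 'rV[R]_n := [set x | norm2 x <= r].
Arguments centered_ball : clear implicits.

Lemma centered_ball_body n (r : R) : 0 < r -> convex_body (centered_ball n r).
Proof.
move=> r0; split.
- apply: convex_set_comb => x y t; rewrite /centered_ball /= => hx hy t0 t1.
  apply: le_trans (norm2D _ _) _; rewrite !norm2Z !ger0_norm ?subr_ge0//.
  have : t * norm2 x <= t * r by rewrite ler_wpM2l.
  have : (1 - t) * norm2 y <= (1 - t) * r by rewrite ler_wpM2l// subr_ge0.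
  lra.
- apply: bounded_closed_compact.
    exists r; split; first exact: num_real.
    move=> s rs x hx; apply/mx_norm_le; first by rewrite ltW// (lt_trans r0).
    by move=> i; apply: le_trans (coord_le_norm2 _ _) _; apply: le_trans hx (ltW rs).
  have -> : centered_ball n r = @norm2 R n @^-1` [set y | y <= r] by [].
  apply: closed_comp; last exact: closed_le.
  by move=> x _; exact: norm2_continuous.
- exists 0; apply/nbhs_ballP; exists (r / n.+1%:R) => /=; first by rewrite divr_gt0.
  move=> x /mx_ballE h; rewrite /centered_ball /=; apply: le_trans (norm2_le_norm _) _.
  have r1 : 0 < r / n.+1%:R by rewrite divr_gt0.
  have {}h : `|x| <= r / n.+1%:R.
    apply/mx_norm_le; first exact: ltW.
    by move=> i; have := h r1 i; rewrite mxE sub0r normrN => /ltW.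
  apply: (@le_trans _ _ (n%:R * (r / n.+1%:R))); first by rewrite ler_wpM2l.
  by rewrite mulrCA -[leRHS]mulr1 ler_wpM2l ?(ltW r0)// ler_pdivrMr// mul1r ler_nat.
Qed.

Lemma centered_ball_volume n (r : R) : 0 < r ->
  lebesgue_rV R n (centered_ball n r) = ((r ^+ n)%:E * lebesgue_rV R n (@ball2 R n))%E.
Proof.
move=> r0; rewrite -[X in (X ^+ n)%:E]invrK.
rewrite -lebesgue_rV_scale ?invr_gt0//; last exact: measurable_ball2.
congr (lebesgue_rV R n _); apply/seteqP; split => x;
  by rewrite /centered_ball /ball2 /= norm2Z gtr0_norm ?invr_gt0// mulrC ler_pdivrMr// mul1r.
Qed.

Lemma centered_ball_support n r (xi : 'rV[R]_n) : 0 < r -> norm2 xi = 1 ->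
  support_fun (centered_ball n r) xi = r.
Proof.
move=> r0 xi1; apply/eqP; rewrite eq_le; apply/andP; split.
  apply: support_le.
    by exists 0; rewrite /centered_ball /= -(scale0r (0 : 'rV[R]_n)) norm2Z normr0 mul0r ltW.
  move=> y hy; apply: le_trans (cauchy_schwarz _ _) _; by rewrite xi1 mul1r.
have [_ cb _] := centered_ball_body n r0.
have := @support_ub R n _ xi (r *: xi) cb.
rewrite dotpZr ((norm2_eq1 xi).1 xi1) mulr1; apply.
by rewrite /centered_ball /= norm2Z xi1 mulr1 gtr0_norm.
Qed.

Lemma norm2_le_sum n (x : 'rV[R]_n) : norm2 x <= \sum_i `|x ord0 i|.
Proof.
have s0 : 0 <= \sum_i `|x ord0 i| by exact: sumr_ge0.
rewrite -(@ler_pXn2r _ 2)// ?nnegrE ?norm2_ge0// norm2_sqr expr2 mulr_suml.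
apply: ler_sum => i _; rewrite -expr2 -real_normK ?num_real// expr2 ler_wpM2l//.
by rewrite (bigD1 i)//= lerDl sumr_ge0.
Qed.

(** Shadows of a ball of radius r are balls of dimension m, so its projection body is
the ball whose radius is their volume [r ^+ m * kappa].  That radius grows with r as
soon as m is positive, so it can be made at least 1. *)
Lemma ball_projection_body m : (0 < m)%N ->
  exists D : set 'rV[R]_m.+1, cross_polytope R m.+1 `<=` D /\ projection_body D.
Proof.
move=> m0; set kappa := fine (lebesgue_rV R m (@ball2 R m)).
have kE : lebesgue_rV R m (@ball2 R m) = kappa%:E.
  by rewrite /kappa fineK// ge0_fin_numE// ball2_lty.
have k0 : 0 < kappa by have := ball2_gt0 R m; rewrite kE lte_fin.
pose r : R := 1 + kappa^-1.
have ik0 : 0 < kappa^-1 by rewrite invr_gt0.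
have r1 : 1 <= r by rewrite /r; lra.
have r0 : 0 < r by lra.
have rk0 : 0 < r ^+ m * kappa by rewrite mulr_gt0// exprn_gt0.
have rk : 1 <= r ^+ m * kappa.
  have rr : r <= r ^+ m by rewrite -[leLHS]expr1 ler_weXn2l.
  apply: (@le_trans _ _ (r * kappa)); last by rewrite ler_wpM2r// ltW.
  by rewrite /r mulrDl mul1r mulVf ?gt_eqF//; lra.
exists (centered_ball m.+1 (r ^+ m * kappa)); split.
  move=> x; rewrite /cross_polytope /centered_ball /= => hx.
  by apply: le_trans (norm2_le_sum x) _; apply: le_trans hx rk.
exists (centered_ball m.+1 r); first exact: centered_ball_body.
split; first exact: centered_ball_body.
- apply/seteqP; split => x; rewrite /centered_ball /=.
    move=> hx; exists (- x); last by rewrite opprK.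
    by rewrite -scaleN1r norm2Z normrN1 mul1r.
  by move=> [y hy <-]; rewrite -scaleN1r norm2Z normrN1 mul1r.
move=> xi xi1; rewrite centered_ball_support// /hyperplane_volume /=.
have [FF Fxi] := hyperplane_basisP xi1.
rewrite (proj_lines xi1 Fxi).
have -> : [set y | exists s, centered_ball m.+1 r (s *: xi + y *m hyperplane_basis xi)] =
    centered_ball m r.
  have nE s y : dotp (s *: xi + y *m hyperplane_basis xi) (s *: xi + y *m hyperplane_basis xi)
      = s ^+ 2 + dotp y y.
    rewrite [in LHS]dotpDr dotpZr (dotp_line xi1 Fxi) dotpDl dotpZl (dotp_mul _ _ FF).
    rewrite (dotpC xi) -[X in dotp X xi]add0r -(scale0r xi) (dotp_line xi1 Fxi).
    ring.
  apply/seteqP; split => y; rewrite /centered_ball /=.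
    move=> [s]; apply: le_trans.
    rewrite -(@ler_pXn2r _ 2)// ?nnegrE ?norm2_ge0// !norm2_sqr nE.
    by rewrite lerDr sqr_ge0.
  move=> hy; exists 0; apply: le_trans hy.
  rewrite -(@ler_pXn2r _ 2)// ?nnegrE ?norm2_ge0// !norm2_sqr nE.
  by rewrite expr0n/= add0r.
by rewrite centered_ball_volume// kE.
Qed.

End euclidean_balls.

(** * Integrals of nonnegative real functions *)

Section nonnegative_real_integrals.
Context d (T : measurableType d) (R : realType) (mu : {measure set T -> \bar R}).
Variables (D : set T) (f g : T -> R).
Hypotheses (mD : measurable D).
Hypotheses (mf : measurable_fun setT f) (f0 : forall x, 0 <= f x).
Hypotheses (mg : measurable_fun setT g) (g0 : forall x, 0 <= g x).
Local Open Scope ereal_scope.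

Let mfE : measurable_fun D (EFin \o f).
Proof. by apply: measurable_funTS; exact/measurable_EFinP. Qed.

Let mgE : measurable_fun D (EFin \o g).
Proof. by apply: measurable_funTS; exact/measurable_EFinP. Qed.

Lemma ge0_integralZ_EFin (k : R) : (0 <= k)%R ->
  \int[mu]_(x in D) (k * f x)%:E = k%:E * \int[mu]_(x in D) (f x)%:E.
Proof.
move=> k0; under eq_integral do rewrite EFinM.
by apply: ge0_integralZl => // x _; rewrite lee_fin.
Qed.

Lemma ge0_integralD_EFin : \int[mu]_(x in D) (f x + g x)%:E =
  \int[mu]_(x in D) (f x)%:E + \int[mu]_(x in D) (g x)%:E.
Proof.
under eq_integral do rewrite EFinD.
by apply: ge0_integralD => // x _; rewrite lee_fin.
Qed.

Lemma ge0_le_integral_EFin : (forall x, D x -> f x <= g x)%R ->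
  \int[mu]_(x in D) (f x)%:E <= \int[mu]_(x in D) (g x)%:E.
Proof.
move=> fg; by apply: ge0_le_integral => // x Dx; rewrite lee_fin// fg.
Qed.

End nonnegative_real_integrals.

(** * Sign symmetry of the sphere *)

Section sign_symmetry.
Context (R : realType) (m : nat).
Local Notation n := m.+1.
Local Notation sigma := (@sphere_measure R n).
Local Notation S := (@sphere R n).

Definition flip (j : 'I_n) : 'M[R]_n := diag_mx (\row_i (-1) ^+ (i == j)).

Lemma flip_orthogonal j : flip j *m (flip j)^T = 1%:M.
Proof.
rewrite /flip tr_diag_mx mulmx_diag; apply/matrixP => i k; rewrite !mxE.
by case: eqP => // _; rewrite -expr2 sqrr_sign.
Qed.

Lemma flipE j (x : 'rV[R]_n) i : (x *m flip j) ord0 i = (-1) ^+ (i == j) * x ord0 i.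
Proof. by rewrite /flip mul_mx_diag !mxE mulrC. Qed.

Variable h : 'rV[R]_n -> R.
Hypotheses (mh : measurable_fun setT h) (h0 : forall x, 0 <= h x).

Let axis (x : 'rV[R]_n) j : 'rV[R]_n := x ord0 j *: delta_mx ord0 j.
(** The average of h over the signs of the coordinates listed in r. *)
Let G r (x : 'rV[R]_n) : R :=
  sign_avg h [seq axis x j | j <- r] (\sum_(j | j \notin r) axis x j).

Let axis_flip x j k : k != j -> axis (x *m flip j) k = axis x k.
Proof. by move=> kj; rewrite /axis flipE (negbTE kj) mul1r. Qed.

Let axis_flip_self x j : axis (x *m flip j) j = - axis x j.
Proof. by rewrite /axis flipE eqxx mulN1r scaleNr. Qed.

Let G_cons j r x : j \notin r -> G (j :: r) x = (G r x + G r (x *m flip j)) / 2.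
Proof.
move=> jr; rewrite /G /=; congr ((_ + _) / 2).
  congr (sign_avg _ _ _); rewrite [RHS](bigD1 j)//= addrC; congr (_ + _).
  by apply: eq_bigl => k; rewrite inE negb_or andbC.
congr (sign_avg _ _ _).
  apply/eq_in_map => k kr; rewrite axis_flip//.
  by apply: contraNneq jr => <-.
rewrite [RHS](bigD1 j)//= axis_flip_self addrC; congr (_ + _).
apply: eq_big => [k|k]; first by rewrite inE negb_or andbC.
by rewrite inE negb_or => /andP[kj _]; rewrite axis_flip.
Qed.

Let G0 r x : 0 <= G r x. Proof. exact: sign_avg_ge0. Qed.

Let G_spec r : uniq r -> measurable_fun setT (G r) /\
  (\int[sigma]_(x in S) (G r x)%:E = \int[sigma]_(x in S) (h x)%:E)%E.
Proof.
elim: r => [_|j r IH /= /andP[jr /IH[mG IG]]].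
  have -> : G [::] = h.
    apply/funext => x; rewrite /G /=; congr h.
    by rewrite [RHS]row_sum_delta.
  by [].
have mGf : measurable_fun setT (fun x => G r (x *m flip j)).
  exact: measurableT_comp mG (measurable_rV_mul _).
have E : G (j :: r) = fun x => 2^-1 * (G r x + G r (x *m flip j)).
  by apply/funext => x; rewrite G_cons// mulrC.
split.
  by rewrite E; apply: measurable_funM => //; exact: measurable_funD.
have mS := @measurable_sphere R m.
rewrite E ge0_integralZ_EFin//; [|exact: measurable_funD|by move=> x; exact: addr_ge0].
rewrite ge0_integralD_EFin//.
have mGE : measurable_fun setT (fun x => (G r x)%:E) by exact/measurable_EFinP.
have -> : (\int[sigma]_(x in S) (G r (x *m flip j))%:E =
    \int[sigma]_(x in S) (G r x)%:E)%E.
  apply: (@sphere_int_orthogonal R m (flip j) (fun x => (G r x)%:E)) => //.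
    exact: flip_orthogonal.
  by move=> x; rewrite lee_fin.
rewrite !IG; set I := (\int[_]_(x in S) _)%E.
have I0 : (0 <= I)%E by apply: integral_ge0 => x _; rewrite lee_fin.
case: I I0 => [z| |]// _; first by rewrite -EFinD -EFinM; congr EFin; field.
by rewrite addye// mulry gtr0_sg ?invr_gt0// mul1e.
Qed.

(** The average over the sign of coordinate j is the mean of a function and of its
composition with the reflection [flip j], which preserves the measure. *)
Lemma sphere_int_sign_avg :
  measurable_fun setT (fun x => sign_avg h [seq axis x j | j <- enum 'I_n] 0) /\
  (\int[sigma]_(x in S) (sign_avg h [seq axis x j | j <- enum 'I_n] 0)%:E =
   \int[sigma]_(x in S) (h x)%:E)%E.
Proof.
have := G_spec (enum_uniq 'I_n).
have -> // : G (enum 'I_n) = fun x => sign_avg h [seq axis x j | j <- enum 'I_n] 0.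
apply/funext => x; rewrite /G; congr (sign_avg _ _ _).
by rewrite big_pred0// => j; rewrite mem_enum.
Qed.

End sign_symmetry.

(** * Mean widths *)

Section widths.
Context (R : realType) (m : nat).
Local Notation n := m.+1.
Local Notation sigma := (@sphere_measure R n).
Local Notation S := (@sphere R n).
Local Notation B1 := (cross_polytope R n).

Let mS : measurable S. Proof. exact: measurable_sphere. Qed.

(** With a = 1 / (6 sqrt n), the coordinate is at least a in absolute value on a
third of the sphere, by [sphere_slab_le]. *)
Lemma sphere_int_coord (j : 'I_n) :
  ((18 * Num.sqrt n%:R)^-1%:E <= \int[sigma]_(x in S) (`|x ord0 j|)%:E)%E.
Proof.
have n0 : 0 < n%:R :> R by [].
have q0 : 0 < Num.sqrt n%:R :> R by rewrite sqrtr_gt0.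
pose a : R := (6 * Num.sqrt n%:R)^-1.
have a0 : 0 < a by rewrite invr_gt0 mulr_gt0.
have an : 32 * n%:R * a ^+ 2 <= 1.
  rewrite /a exprVn exprMn sqr_sqrtr ?ler0n// ler_pdivrMr ?mulr_gt0// mul1r.
  by rewrite ler_wpM2r// -natrX ler_nat.
have slab := sphere_slab_le j a0 an.
set A := mkset _ in slab.
have mA : measurable A by exact: measurable_slab.
have mSA : measurable (S `\` A) by exact: measurableD.
have SA : ((1 / 3)%:E <= sigma (S `\` A))%E.
  have : (1%:E <= sigma (S `\` A) + (2 / 3)%:E)%E.
    rewrite -(sphere_measure_sphere R m).
    apply: (@le_trans _ _ (sigma (S `\` A) + sigma A)%E); last by rewrite leeD2l.
    apply: (@le_trans _ _ (sigma ((S `\` A) `|` A))).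
      apply: le_measure; rewrite ?inE//; first exact: measurableU.
      by move=> x Sx; have [Ax|Ax] := pselect (A x); [right|left].
    exact: measureU2.
  have : (0 <= sigma (S `\` A))%E by [].
  move: (sigma (S `\` A)) => t; move: t => [z| |]; rewrite ?leey ?leeNy_eq//.
  by rewrite -EFinD !lee_fin; lra.
have mI : measurable_fun setT (\1_(S `\` A) : 'rV[R]_n -> R) by exact: measurable_indic.
apply: (@le_trans _ _ (\int[sigma]_(x in S) (a * \1_(S `\` A) x)%:E)%E).
  rewrite ge0_integralZ_EFin//; last exact: ltW.
  rewrite integral_indic// (_ : _ `&` S = S `\` A); last first.
    by rewrite setIC; apply/setIidPr => x [].
  apply: (@le_trans _ _ (a%:E * (1 / 3)%:E)%E); last first.
    by apply: lee_wpmul2l => //; rewrite lee_fin ltW.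
  rewrite -EFinM lee_fin le_eqVlt; apply/orP; left; apply/eqP; rewrite /a.
  by field; rewrite gt_eqF.
apply: ge0_le_integral_EFin => //.
- exact: measurable_funM.
- by move=> x; rewrite mulr_ge0// ltW.
- by apply: measurableT_comp => //; exact: measurable_coord.
move=> x Sx; rewrite indicE.
case: (boolP (x \in _)) => [/set_mem[_ Ax]|_]; last by rewrite mulr0.
by rewrite mulr1 leNgt; apply/negP.
Qed.

Let Sn : S !=set0.
Proof.
exists (1 *: delta_mx ord0 ord0).
by rewrite /sphere /= norm2_axis normr1.
Qed.

Lemma sphere_int_bounded (g : 'rV[R]_n -> R) (M : R) : measurable_fun setT g ->
  (forall x, 0 <= g x) -> (forall x, S x -> g x <= M) ->
  (\int[sigma]_(x in S) (g x)%:E <= M%:E)%E.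
Proof.
move=> mg g0 gM.
apply: (@le_trans _ _ (\int[sigma]_(x in S) M%:E)%E).
  apply: (@le_trans _ _ (\int[sigma]_(x in S) (Num.max M 0)%:E)%E); last first.
    rewrite (_ : Num.max M 0 = M)//; apply/max_idPl.
    by have [x Sx] := Sn; exact: le_trans (g0 x) (gM x Sx).
  have M0 : 0 <= Num.max M 0 by rewrite le_max lexx orbT.
  by apply: ge0_le_integral_EFin => // x Sx; rewrite le_max gM.
by rewrite integral_cst// [X in (_ * X)%E](sphere_measure_sphere R m) mule1.
Qed.

Lemma mean_widthE (K : set 'rV[R]_n) : compact K -> K !=set0 ->
  (forall x, 0 <= support_fun K x) ->
  (mean_width K)%:E = (\int[sigma]_(x in S) (support_fun K x)%:E)%E.
Proof.
move=> cK K0 h0; rewrite /mean_width /Rintegral fineK//.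
have [M M0 KM] := compact_sub_cube cK.
have mh : measurable_fun setT (support_fun K).
  by apply: continuous_measurable_rV; exact: support_continuous.
have := @sphere_int_bounded _ (n%:R * 1 * M) mh h0.
move=> /(_ _)/le_lt_trans H; rewrite ge0_fin_numE ?H ?ltry//.
- move=> x Sx; apply: support_le => // y Ky; apply: le_trans (ler_norm _) _.
  apply: le_trans (norm_dotp_le _ _) _.
  apply: ler_pM; rewrite ?mulr_ge0//.
    rewrite ler_wpM2l//; apply/mx_norm_le => // i.
    by apply: le_trans (coord_le_norm2 _ _) _; rewrite Sx.
  by apply/mx_norm_le; [exact: ltW|exact: KM].
- by apply: integral_ge0 => x _; rewrite lee_fin.
Qed.

(** Integrate [projection_average] over the sphere: the left side is at least
sqrt n / 18 by [sphere_int_coord], and the right side is 4 sqrt n times the mean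
width by [sphere_int_sign_avg]. *)
Lemma projection_body_width (D : set 'rV[R]_n) : projection_body D -> B1 `<=` D ->
  1 / 72 <= mean_width D.
Proof.
move=> [K bK pD] BD.
have [[cvxD cD iD] symD _] := pD.
have D0 : D !=set0 by have [x /nbhs_singleton Dx] := iD; exists x.
have Dz : D 0.
  have [x Dx] := D0; have Dnx : D (- x) by rewrite symD; exists x.
  have := convex_comb (t := 1 / 2) cvxD Dx Dnx.
  rewrite scalerN (_ : 1 - 1 / 2 = 1 / 2); last by field.
  by rewrite subrr; apply; lra.
have h0 x : 0 <= support_fun D x by exact: support_ge0.
have mh : measurable_fun setT (support_fun D).
  by apply: continuous_measurable_rV; exact: support_continuous.
have [mr ir] := sphere_int_sign_avg mh h0.
have n0 : 0 < n%:R :> R by [].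
have q0 : 0 < Num.sqrt n%:R :> R by rewrite sqrtr_gt0.
have q2 : Num.sqrt n%:R ^+ 2 = n%:R :> R by rewrite sqr_sqrtr.
have up : (\int[sigma]_(x in S) (\sum_j `|x ord0 j|)%:E <=
    (4 * Num.sqrt n%:R * mean_width D)%:E)%E.
  rewrite EFinM (mean_widthE cD D0 h0) -ir -ge0_integralZ_EFin//; last first.
    by move=> x; exact: sign_avg_ge0.
  apply: ge0_le_integral_EFin => //.
  - apply: measurable_sum => j.
    by apply: measurableT_comp => //; exact: measurable_coord.
  - by move=> x; exact: sumr_ge0.
  - exact: measurable_funM.
  move=> x Sx; apply: (projection_average bK pD BD).
  by rewrite Sx.
have low : ((n%:R * (18 * Num.sqrt n%:R)^-1)%:E <=
    \int[sigma]_(x in S) (\sum_j `|x ord0 j|)%:E)%E.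
  under eq_integral do rewrite -sumEFin.
  rewrite ge0_integral_sum//; last first.
    move=> j; apply: measurable_funTS; apply/measurable_EFinP.
    by apply: measurableT_comp => //; exact: measurable_coord.
  rewrite -[X in (X%:R * _)%:E](card_ord n) mulr_natl -sumr_const -sumEFin.
  by apply: lee_sum => j _; exact: sphere_int_coord.
have := le_trans low up; rewrite lee_fin.
move: q0 q2; set q : R := Num.sqrt _ => q0 <-.
have -> : q ^+ 2 / (18 * q) = q * (1 / 18) by field; rewrite gt_eqF.
have -> : 4 * q * mean_width D = q * (4 * mean_width D) by ring.
by rewrite (ler_pM2l q0) => h; clear -h; lra.
Qed.

Let cB1 : compact B1.
Proof.
apply: bounded_closed_compact.
  exists 1; split; first exact: num_real.
  move=> s s1 x hx; apply/mx_norm_le; first by rewrite ltW// (lt_trans ltr01).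
  move=> i; apply: le_trans (ltW s1); apply: le_trans hx.
  by rewrite (bigD1 i)//= lerDl sumr_ge0.
have -> : B1 = (fun x : 'rV[R]_n => \sum_i `|x ord0 i|) @^-1` [set y | y <= 1] by [].
apply: closed_comp; last exact: closed_le.
move=> x _; apply: (@lipschitz_continuous_fun _ _ _ _ n%:R) => y z.
rewrite -sumrB; apply: le_trans (ler_norm_sum _ _ _) _.
rewrite mulr_natl -[X in _ *+ X](card_ord n) -sumr_const.
apply: ler_sum => i _; apply: le_trans (ler_dist_dist _ _) _.
by have := coord_le_norm (y - z) i; rewrite !mxE.
Qed.

Let B1z : B1 0.
Proof. by rewrite /cross_polytope /= big1// => i _; rewrite mxE normr0. Qed.

Let B1n : B1 !=set0. Proof. by exists 0. Qed.

Let hB0 x : 0 <= support_fun B1 x.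
Proof. exact: support_ge0. Qed.

Let mhB : measurable_fun setT (support_fun B1).
Proof. by apply: continuous_measurable_rV; exact: support_continuous. Qed.

Lemma cross_polytope_width_gt0 : 0 < mean_width B1.
Proof.
rewrite -lte_fin (mean_widthE cB1 B1n hB0).
apply: (@lt_le_trans _ _ (\int[sigma]_(x in S) (`|x ord0 ord0|)%:E)%E).
  apply: lt_le_trans (sphere_int_coord ord0).
  by rewrite lte_fin invr_gt0 mulr_gt0// sqrtr_gt0.
apply: ge0_le_integral_EFin => //.
  by apply: measurableT_comp => //; exact: measurable_coord.
move=> x _; rewrite normrEsg -dotp_axis.
apply: support_ub => //; apply: cross_polytope_axis.
by rewrite normr_sg; case: (_ != 0).
Qed.

Let support_cross_le (x : 'rV[R]_n) (s : R) : (forall i, `|x ord0 i| <= s) -> 0 <= s ->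
  support_fun B1 x <= s.
Proof.
move=> xs s0; apply: support_le => // y hy.
apply: le_trans (ler_norm _) _; apply: le_trans (ler_norm_sum _ _ _) _.
apply: (@le_trans _ _ (\sum_i s * `|y ord0 i|)).
  by apply: ler_sum => i _; rewrite normrM ler_wpM2r.
by rewrite -mulr_sumr -[leRHS]mulr1 ler_wpM2l.
Qed.

Lemma cross_polytope_width_le1 : mean_width B1 <= 1.
Proof.
rewrite -lee_fin (mean_widthE cB1 B1n hB0); apply: sphere_int_bounded => // x Sx.
by apply: support_cross_le => // i; rewrite -[leRHS]Sx; exact: coord_le_norm2.
Qed.

(** On the sphere the support function, the maximum of the |x_j|, is at most 1, and it
is at most s outside the union of the 2 n caps of height s around the vertices. *)
Lemma cross_polytope_width_cap (s : R) : 0 <= s -> 2 * s ^+ 2 <= 1 ->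
  mean_width B1 <= s + 2 * n%:R * Num.sqrt (1 - s ^+ 2) ^+ n.
Proof.
move=> s0 s1; rewrite -lee_fin (mean_widthE cB1 B1n hB0).
set rho := Num.sqrt _ ^+ n.
pose C (a : R) j := S `&` [set x : 'rV[R]_n | s <= dotp x (a *: delta_mx ord0 j)].
have mC a j : measurable (C a j).
  by apply: measurableI => //; exact: measurable_halfspace.
have mI a j : measurable_fun setT (\1_(C a j) : 'rV[R]_n -> R).
  exact: measurable_indic.
have IC a j : `|a| = 1 -> (\int[sigma]_(x in S) (\1_(C a j) x)%:E <= rho%:E)%E.
  move=> a1; rewrite integral_indic// setIC.
  have -> : S `&` C a j = C a j by apply/setIidPr => x [].
  by apply: sphere_cap_le => //; rewrite norm2_axis.
pose g j (x : 'rV[R]_n) : R := \1_(C 1 j) x + \1_(C (-1) j) x.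
have g0 j x : 0 <= g j x by rewrite addr_ge0.
have mg j : measurable_fun setT (g j) by exact: measurable_funD.
have mG : measurable_fun setT (fun x => \sum_j g j x) by exact: measurable_sum.
have G0 x : 0 <= \sum_j g j x by exact: sumr_ge0.
apply: (@le_trans _ _ (\int[sigma]_(x in S) (s + \sum_j g j x)%:E)%E).
  apply: ge0_le_integral_EFin => //.
    exact: measurable_funD.
  move=> x Sx.
  have [xs|] := pselect (forall i, `|x ord0 i| <= s).
    by rewrite -[leLHS]addr0 lerD// support_cross_le.
  move=> /existsNP[j /negP]; rewrite -ltNge => sj.
  rewrite -[leLHS]add0r; apply: lerD => //; apply: (@le_trans _ _ 1).
    by apply: support_cross_le => // i; rewrite -[leRHS]Sx; exact: coord_le_norm2.
  rewrite (bigD1 j)//= -[leLHS]addr0; apply: lerD; last exact: sumr_ge0.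
  rewrite /g !indicE.
  have [xj|xj] := leP 0 (x ord0 j).
    rewrite (_ : x \in C 1 j) ?lerDl//; apply/mem_set; split => //=.
    by rewrite dotp_axis mul1r -(ger0_norm xj) ltW.
  rewrite (_ : x \in C (-1) j) ?lerDr//; apply/mem_set; split => //=.
  by rewrite dotp_axis mulN1r -(ltr0_norm xj) ltW.
rewrite ge0_integralD_EFin// EFinD; apply: leeD.
  by rewrite integral_cst// [X in (_ * X)%E](sphere_measure_sphere R m) mule1.
under eq_integral do rewrite -sumEFin.
rewrite ge0_integral_sum//; last 2 first.
- by move=> j; apply: measurable_funTS; exact/measurable_EFinP.
- by move=> j x _; rewrite lee_fin.
apply: (@le_trans _ _ (\sum_(j < n) (2 * rho)%:E)%E).
  apply: lee_sum => j _; rewrite ge0_integralD_EFin//.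
  rewrite (_ : 2 * rho = rho + rho); last by ring.
  by rewrite EFinD; apply: leeD; apply: IC; rewrite ?normr1 ?normrN1.
rewrite sumEFin lee_fin sumr_const card_ord -[_ *+ _]mulr_natl.
by rewrite le_eqVlt; apply/orP; left; apply/eqP; ring.
Qed.

(** Use caps of height s = 2 sqrt (log n / n): each has measure at most n^(-2), so the
union of the caps contributes at most 2 / n, which is of smaller order than s.
If n is so small that [sphere_cap_le] does not apply to s, then 2 s >= 1 and the
trivial bound 1 suffices. *)
Lemma cross_polytope_width_le : (0 < m)%N ->
  mean_width B1 <= 4 * Num.sqrt (ln n%:R / n%:R).
Proof.
move=> m0; set L := ln n%:R : R; set y := Num.sqrt _.
have n0 : 0 < n%:R :> R by [].
have L2 : 1 / 2 <= L.
  have key (z : R) : 0 < z -> ln z <= z - 1.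
    move=> z0; have -> : ln z = ln (1 + (z - 1)) by rewrite addrC subrK.
    by apply: le_ln1Dx; lra.
  have := key n%:R^-1; rewrite invr_gt0 lnV ?posrE// -/L => /(_ n0).
  have : n%:R^-1 <= 2^-1 :> R by rewrite lef_pV2 ?posrE// ler_nat.
  by move: (n%:R^-1 : R) => z; lra.
have y0 : 0 <= y by exact: sqrtr_ge0.
have y2 : y ^+ 2 = L / n%:R by rewrite sqr_sqrtr// divr_ge0//; lra.
have [s1|s1] := leP (2 * (2 * y) ^+ 2) 1; last first.
  apply: le_trans cross_polytope_width_le1 _.
  rewrite leNgt; apply/negP => h; move: s1; rewrite ltNge => /negP; apply.
  have : y * y <= y * (1 / 4) by rewrite ler_wpM2l//; lra.
  lra.
apply: le_trans (cross_polytope_width_cap _ s1) _; first by rewrite mulr_ge0.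
set rho := Num.sqrt _ ^+ n.
have rho_le : rho <= n%:R^-1 ^+ 2.
  rewrite -(@ler_pXn2r _ 2)// ?nnegrE ?exprn_ge0 ?sqrtr_ge0 ?invr_ge0//.
  rewrite /rho -exprM mulnC exprM sqr_sqrtr; last lra.
  apply: (@le_trans _ _ (expR (- (2 * y) ^+ 2) ^+ n)).
    apply: lerXn2r; rewrite ?nnegrE; [lra|exact: expR_ge0|exact: expR_ge1Dx].
  rewrite -expRM_natl exprMn y2.
  rewrite (_ : n%:R * _ = 4%:R * (- L)); last by field; rewrite gt_eqF.
  by rewrite expRM_natl expRN lnK ?posrE// -exprM.
have : 2 * n%:R * rho <= 2 * n%:R * n%:R^-1 ^+ 2 by rewrite ler_wpM2l ?mulr_ge0.
rewrite (_ : 2 * n%:R * n%:R^-1 ^+ 2 = 2 * n%:R^-1); last by field; rewrite gt_eqF.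
have : n%:R^-1 <= y.
  rewrite -(@ler_pXn2r _ 2)// ?nnegrE ?invr_ge0// y2 expr2 mulrC ler_wpM2r ?invr_ge0//.
  apply: le_trans L2; rewrite div1r lef_pV2 ?posrE// ler_nat//.
move=> h1 h2; apply: le_trans (lerD (lexx _) h2) _.
by move: (n%:R^-1 : R) h1 => z; lra.
Qed.

End widths.

Theorem mainTheorem13 (R : realType) :
  exists2 c : R, 0 < c &
    forall n : nat, (2 <= n)%N ->
      c * Num.sqrt (n%:R / ln n%:R)
        <= mean_width_dist (cross_polytope R n) (@projection_body R n).
Proof.
exists (1 / 288) => [|[|m]// m1]; first by lra.
have [D [BD pD]] := @ball_projection_body R m m1.
apply: lb_le_inf; first by exists (mean_width D / mean_width (cross_polytope R m.+1)), D.
move=> _ [E [BE pE] <-].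
have wB := cross_polytope_width_gt0 R m.
have wB' := cross_polytope_width_le R m1.
have wE := projection_body_width pE BE.
set w := mean_width (cross_polytope _ _) in wB wB' *; set v := mean_width E in wE *.
set y := Num.sqrt (_ / m.+1%:R) in wB'.
have -> : Num.sqrt (m.+1%:R / ln m.+1%:R) = y^-1 :> R.
  by rewrite -sqrtrV ?invf_div// divr_ge0// ln_ge0// ler1n.
have y0 : 0 < y by lra.
rewrite ler_pdivlMr// -mulrA [y^-1 * w]mulrC mulrA ler_pdivrMr//.
have : 1 / 72 * y <= v * y by rewrite ler_pM2r.
lra.
Qed.
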